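(* Let $\|\cdot\|_{\mathbb{R}^2}$ be any norm on $\mathbb{R}^2$. Then there exists $\rho_0>0$ such that $(\rho_0^{-1},\infty)\subset\mathcal{L}_2$. In other words, there exists $\rho_0>0$ such that for every $\rho\in(0,\rho_0)$ there is $x\in\mathbb{R}^2\setminus\mathbb{Q}^2$ satisfying $$\liminf_{q\to\infty}q^{1/2}\|qx\|_{\mathbb{T}^2}=\rho .$$
   Context: For the given norm on $\mathbb{R}^2$ and $x\in\mathbb{R}^2$, write $\|x\|_{\mathbb{T}^2}=\min_{p\in\mathbb{Z}^2}\|x-p\|_{\mathbb{R}^2}$. In the liminf, $q$ ranges over positive integers. The $2$-dimensional Lagrange spectrum (for the given norm) is $$\mathcal{L}_2=\Big\{\big(\liminf_{q\to\infty}q^{1/2}\|q\theta\|_{\mathbb{T}^2}\big)^{-1}:\theta\in\mathbb{R}^2\Big\},$$ with $1/0=\infty$. No smoothness or strict convexity of the norm is assumed. *)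

(* Defs.v *)
From HB Require Import structures.
From mathcomp Require Import all_boot all_order all_algebra.
From mathcomp Require Import all_classical all_reals all_analysis.
From mathcomp Require Import zify.

Set Implicit Arguments.
Unset Strict Implicit.
Unset Printing Implicit Defensive.

Import Order.TTheory GRing.Theory Num.Theory.
Import numFieldNormedType.Exports.

Local Open Scope classical_set_scope.
Local Open Scope ring_scope.

(* The type 'rV[R]_2 already carries the sup norm `|x|, so an arbitrary norm on
   the plane is a function satisfying the axioms below. *)
Record is_norm (R : realType) (N : 'rV[R]_2 -> R) : Prop := IsNorm {
  is_norm_triangle : forall x y, N (x + y) <= N x + N y;
  is_norm_scale : forall (a : R) x, N (a *: x) = `|a| * N x;
  is_norm_eq0 : forall x, N x = 0 -> x = 0 }.

Definition Z2 (R : realType) : set 'rV[R]_2 :=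
  range (fun z : 'rV[int]_2 => map_mx (intr : int -> R) z).

Definition Q2 (R : realType) : set 'rV[R]_2 :=
  range (fun r : 'rV[rat]_2 => map_mx (ratr : rat -> R) r).

(* The infimum is a minimum: see torus_norm_min at the end of the file. *)
Definition torus_norm (R : realType) (N : 'rV[R]_2 -> R) (x : 'rV[R]_2) : R :=
  inf [set N (x - p) | p in @Z2 R].

(* The index q = 0 is harmless, a liminf ignores finitely many terms. *)
Definition liminf_torus (R : realType) (N : 'rV[R]_2 -> R) (x : 'rV[R]_2) :
    \bar R :=
  limn_einf (fun q : nat => (Num.sqrt q%:R * torus_norm N (q%:R *: x))%:E).

(* Inversion in \bar R satisfies 0^-1 = +oo (inve0). *)
Definition Lagrange_spectrum2 (R : realType) (N : 'rV[R]_2 -> R) :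
    set (\bar R) :=
  [set ((liminf_torus N theta)^-1)%E | theta in [set: 'rV[R]_2]].

Lemma is_norm0 (R : realType) (N : 'rV[R]_2 -> R) : is_norm N -> N 0 = 0.
Proof.
by move=> nN; rewrite -(scale0r (0 : 'rV[R]_2)) is_norm_scale// normr0 mul0r.
Qed.

Lemma is_normN (R : realType) (N : 'rV[R]_2 -> R) x : is_norm N -> N (- x) = N x.
Proof. by move=> nN; rewrite -scaleN1r is_norm_scale// normrN1 mul1r. Qed.

Lemma is_norm_ge0 (R : realType) (N : 'rV[R]_2 -> R) x : is_norm N -> 0 <= N x.
Proof.
move=> nN; have := is_norm_triangle nN x (- x).
by rewrite subrr is_norm0// is_normN// -mulr2n pmulrn_lge0.
Qed.

Lemma is_norm_dist (R : realType) (N : 'rV[R]_2 -> R) x y :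
  is_norm N -> `|N x - N y| <= N (x - y).
Proof.
move=> nN; rewrite ler_norml lerNl opprB !lerBlDr; apply/andP; split.
  by rewrite -(is_normN (x - y) nN) opprB -{1}(subrK x y) is_norm_triangle.
by rewrite -{1}(subrK y x) is_norm_triangle.
Qed.

Lemma le_mx_norm (R : realType) (x : 'rV[R]_2) j : `|x ord0 j| <= `|x|.
Proof.
rewrite [leRHS]/Num.norm /= mx_normrE.
by apply: (le_bigmax _ (fun k : 'I_1 * 'I_2 => `|x k.1 k.2|) (ord0, j)).
Qed.

Lemma is_norm_le (R : realType) (N : 'rV[R]_2 -> R) : is_norm N ->
  forall x, N x <= (N (delta_mx 0 0) + N (delta_mx 0 1)) * `|x|.
Proof.
move=> nN x; rewrite {1}(row_sum_delta x) !big_ord_recl big_ord0 addr0.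
apply: le_trans (is_norm_triangle nN _ _) _.
rewrite !is_norm_scale// mulrDl ![_ * `|x|]mulrC.
have -> : lift ord0 ord0 = 1 :> 'I_2 by apply: val_inj.
by apply: lerD; apply: ler_wpM2r; rewrite ?le_mx_norm// is_norm_ge0.
Qed.

Lemma is_norm_continuous (R : realType) (N : 'rV[R]_2 -> R) :
  is_norm N -> continuous N.
Proof.
move=> nN x; set C := N (delta_mx 0 0) + N (delta_mx 0 1).
have C0 : 0 <= C by rewrite addr_ge0// is_norm_ge0.
have C1 : 0 < C + 1 by rewrite ltr_wpDl.
apply/(@cvgrPdist_le _ _ _ (nbhs x) (nbhs_filter x)) => e e0; apply/nbhs_ballP.
exists (e / (C + 1)) => /=; first by rewrite divr_gt0.
move=> y; rewrite -ball_normE /= ltr_pdivlMr// => /ltW xy.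
apply: le_trans (is_norm_dist _ _ nN) _; apply: le_trans (is_norm_le nN _) _.
by apply: le_trans xy; rewrite mulrC ler_wpM2l// lerDl.
Qed.

Lemma is_norm_coercive (R : realType) (N : 'rV[R]_2 -> R) : is_norm N ->
  exists2 c, 0 < c & forall x, c * `|x| <= N x.
Proof.
move=> nN; pose S := [set x : 'rV[R]_2 | `|x| = 1].
have S0 : S !=set0.
  have d0 : delta_mx 0 0 != 0 :> 'rV[R]_2.
    by apply/eqP => /rowP/(_ 0)/eqP; rewrite !mxE eqxx oner_eq0.
  exists (`|delta_mx 0 0 : 'rV[R]_2|^-1 *: delta_mx 0 0).
  by rewrite /S /= normrZ normfV normr_id mulVf// normr_eq0.
have cS : compact S.
  apply: bounded_closed_compact.
    by exists 1; split => // y y1 x /= ->; exact: ltW.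
  apply: (@preimage_closed _ _ _ [set 1 : R]); last exact: closed_eq.
  by move=> x _; exact: norm_continuous.
have [x0 /set_mem x01 Nx0] :=
  compact_EVT_min S0 cS (continuous_subspaceT (is_norm_continuous nN)).
exists (N x0).
  rewrite lt_neqAle is_norm_ge0// andbT eq_sym; apply/eqP => /(is_norm_eq0 nN) x00.
  by move: x01; rewrite /S /= x00 normr0 => /eqP; rewrite eq_sym oner_eq0.
move=> x; have [->|x_neq0] := eqVneq x 0; first by rewrite normr0 mulr0 is_norm0.
have nx : 0 < `|x| by rewrite normr_gt0.
have := Nx0 (`|x|^-1 *: x); rewrite is_norm_scale// normfV normr_id mulrC ler_pdivlMr//.
rewrite mulrC => ->//.
by apply/mem_set; rewrite /S /= normrZ normfV normr_id mulVf// gt_eqF.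
Qed.

Lemma torus_norm_min (R : realType) (N : 'rV[R]_2 -> R) (x : 'rV[R]_2) :
  is_norm N ->
  exists2 p, Z2 p &
    torus_norm N x = N (x - p) /\ forall q, Z2 q -> N (x - p) <= N (x - q).
Proof.
move=> nN; have [c c0 cN] := is_norm_coercive nN.
suff [p Zp minp] : exists2 p, Z2 p & forall q, Z2 q -> N (x - p) <= N (x - q).
  exists p => //; split=> //; apply/eqP; rewrite eq_le; apply/andP; split.
    apply: ge_inf; last by exists p.
    by exists 0 => _ [q _ <-]; exact: is_norm_ge0.
  by apply: lb_le_inf => [|_ [q Zq <-]]; [exists (N (x - p)), p|exact: minp].
pose M := Num.truncn (`|x| + c^-1 * N x).
pose f (w : {ffun 'I_2 -> 'I_(M + M).+1}) : 'rV[int]_2 :=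
  \row_j ((w j : nat)%:Z - M%:Z).
pose g w : 'rV[R]_2 := map_mx intr (f w).
pose w0 : {ffun 'I_2 -> 'I_(M + M).+1} := [ffun=> inord M].
have g0 : g w0 = 0.
  apply/rowP => j; rewrite !mxE ffunE inordK ?subrr//.
  by rewrite ltnS leq_addr.
have [w _ minw] := @arg_minP _ R _ w0 xpredT (fun w => N (x - g w)) isT.
exists (g w); first by exists (f w).
move=> _ [z _ <-]; set q := map_mx _ z.
have [Nq|Nq] := ltP (N x) (N (x - q)).
  by apply: le_trans (minw w0 isT) _; rewrite g0 subr0 ltW.
have qM j : (`|z ord0 j| <= M)%N.
  rewrite truncn_ge_nat; last first.
    by rewrite addr_ge0// mulr_ge0 ?is_norm_ge0// invr_ge0 ltW.
  have -> : `|z ord0 j|%N%:R = `|q ord0 j| by rewrite mxE -intr_norm natr_absz.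
  apply: le_trans (le_mx_norm _ _) _.
  rewrite -(subrK x q); apply: le_trans (ler_normD _ _) _.
  rewrite [leRHS]addrC; apply: lerD => //; rewrite distrC ler_pdivlMl//.
  exact: le_trans (cN _) Nq.
suff [w' <-] : exists w', g w' = q by exact: minw.
exists [ffun j => inord (absz (z ord0 j + M%:Z))].
apply/rowP => j; rewrite !mxE ffunE (ord1 0); congr (_%:~R).
have := qM j; move: (z ord0 j) => k kM.
have kM0 : 0 <= k + M%:Z by lia.
rewrite inordK; first by rewrite gez0_abs// addrK.
by rewrite -ltz_nat gez0_abs//; lia.
Qed.

(* Main.v *)
Require Import Defs.
From mathcomp Require Import all_boot all_order all_algebra.
From mathcomp Require Import all_classical all_reals all_analysis.
From mathcomp Require Import zify ring lra.
Set Implicit Arguments.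
Unset Strict Implicit.
Unset Printing Implicit Defensive.
Import Order.TTheory GRing.Theory Num.Theory.
Import numFieldNormedType.Exports.
Local Open Scope classical_set_scope.
Local Open Scope ring_scope.

(** Read an integer vector (p, q) = (a, b, c), with p = (a, b) and q = c, as the
    element a + b t + c t^2 of the cubic field Q(t), t^3 = 2.  The field has a
    real embedding [psi] and a complex one zeta = ([zeta_re], [zeta_im]), and
    psi * |zeta|^2 is the norm, a nonzero integer unless the vector is zero
    ([psi_zeta_ge1]).  The unit u = 1 + t + t^2 multiplies psi by a number
    lam > 1, and multiplies zeta by lam^(-1/2) times a rotation whose angle is
    not a rational multiple of pi ([rotn_neq0]).  The involution [flip], which
    negates c, does not preserve the two embeddings.

    The point x is the limit of the points with projective coordinates
    M_k (axis), where M_k = u^(n_0) flip u^(n_1) flip ... flip and the axis is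
    the eigenvector of u on which zeta vanishes.  In the coordinates of stage k,
    that is for (p, q) = M_k w, the denominator q is a multiple of a linear form
    close to psi - 4 zeta_re, and p - q x is close to a multiple of A_k zeta(w)
    for a linear map A_k from the plane of zeta to the plane of x.  The scalar
    factors cancel in sqrt q * N (p - q x), which is therefore close to
       [cost] A_k w = sqrt |psi w - 4 zeta_re w| * N (A_k (zeta w)).
    The errors are small compared with the main terms unless w is very close to
    the axis or to the kernel of the form, and when the exponents n_k tend to
    infinity every (p, q) with large q and bounded quality
    sqrt q * N (p - q x) avoids both at one of the stages
    ([enter_chain], [chain_step]).  So the liminf in question is the liminf of
    inf_w cost A_k w ([quality_liminf_ge], [quality_le]).

    It remains to steer the matrices A_k.  Up to an exponentially small error
    A_(k+1) = A_k R h, where R is the rotation by n_k times the angle of u and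
    h = diag (-sqrt 3, 1 / sqrt 3) comes from flip ([step_fbasis]).  As the
    angle is irrational, n_k can be chosen so that R is as close as desired to
    any given rotation ([rotn_dense]).  Consider 2 j steps, the first j with one
    common rotation, the last j retracing them ([planned_return]); they bring A
    back up to a rotation.  If consecutive steps cancel, the path alternates
    between A and A R h, and cost is bounded below by a constant that depends
    only on N.  If the steps add up, the path goes to A h^j, and for large j
    some cost is below any prescribed rho.  The infimum of cost along the path
    depends continuously on the common rotation, so that it takes the value rho
    ([exact_plan]).  Following such a path again and again, each time planned
    anew from the present A and followed with a smaller error, keeps A bounded
    and gives liminf exactly rho.  The value is attained for every rho below a
    constant depending on N because only the number j depends on rho. *)

(** * The norm form of the field of the cube root of two *)

Definition Z3 := (int * int * int)%type.

Definition cubic_norm (w : Z3) : int :=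
  let: (a, b, c) := w in a ^+ 3 + 2 * b ^+ 3 + 4 * c ^+ 3 - 6 * (a * b * c).

Lemma odd_or_even (a : int) : exists k, a = 2 * k \/ a = 2 * k + 1.
Proof.
exists (a %/ 2)%Z; have := divz_eq a 2.
have := modz_ge0 a (isT : 2 != 0 :> int); have := ltz_pmod a (isT : 0 < 2 :> int).
lia.
Qed.

(** Infinite descent: the equation forces a, then b, then c to be even, because
    x^3 - 2 is Eisenstein at 2. *)
Lemma cubic_norm_eq0 w : cubic_norm w = 0 -> w = (0, 0, 0).
Proof.
case: w => [[a b] c].
have [n] := ubnP (`|a| + `|b| + `|c|)%N.
elim: n a b c => // n IHn a b c le_n h0.
have nodd (m : int) : 2 * m + 1 <> 0 by clear; lia.
have [a' [a_eq|a_eq]] := odd_or_even a; last first.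
  case: (nodd (4 * a' ^+ 3 + 6 * a' ^+ 2 + 3 * a' + b ^+ 3 + 2 * c ^+ 3
               - 3 * (a * b * c))).
  by rewrite -h0 /cubic_norm a_eq; ring.
have [b' [b_eq|b_eq]] := odd_or_even b; last first.
  case: (nodd (2 * a' ^+ 3 + 4 * b' ^+ 3 + 6 * b' ^+ 2 + 3 * b' + c ^+ 3
               - 3 * (a' * b * c))).
  apply: (mulfI (_ : 2 != 0 :> int)) => //.
  by rewrite mulr0 -h0 /cubic_norm a_eq b_eq; ring.
have [c' [c_eq|c_eq]] := odd_or_even c; last first.
  case: (nodd (a' ^+ 3 + 2 * b' ^+ 3 + 4 * c' ^+ 3 + 6 * c' ^+ 2 + 3 * c'
               - 3 * (a' * b' * c))).
  apply: (mulfI (_ : 4 != 0 :> int)) => //.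
  by rewrite mulr0 -h0 /cubic_norm a_eq b_eq c_eq; ring.
have [abc0|abc_neq0] := eqVneq (`|a| + `|b| + `|c|)%N 0%N.
  by move: abc0; clear; move=> abc0; do 2?congr pair; lia.
have h0' : cubic_norm (a', b', c') = 0.
  apply: (mulfI (_ : 8 != 0 :> int)) => //.
  by rewrite mulr0 -h0 /cubic_norm a_eq b_eq c_eq; ring.
have le_n' : (`|a'| + `|b'| + `|c'| < n)%N.
  by move: le_n abc_neq0; rewrite a_eq b_eq c_eq; clear; lia.
have [a0 b0 c0] := IHn _ _ _ le_n' h0'.
by rewrite a_eq b_eq c_eq a0 b0 c0.
Qed.

(** Multiplication by the unit 1 + t + t^2, with inverse t - 1. *)
Definition unit_mul (w : Z3) : Z3 :=
  let: (a, b, c) := w in (a + 2 * b + 2 * c, a + b + 2 * c, a + b + c).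
Definition unit_div (w : Z3) : Z3 :=
  let: (a, b, c) := w in (2 * c - a, a - b, b - c).
(** Not multiplication by a field element: it mixes the two embeddings.  With the
    normalization of zeta chosen below it acts diagonally on zeta, up to multiples
    of psi ([zeta_re_flip], [zeta_im_flip]). *)
Definition flip (w : Z3) : Z3 := let: (a, b, c) := w in (a, b, - c).

Lemma unit_divK : cancel unit_div unit_mul.
Proof. by move=> [[a b] c] /=; do 2?congr pair; ring. Qed.
Lemma flipK : involutive flip.
Proof. by move=> [[a b] c] /=; rewrite opprK. Qed.
Lemma flip_neq0 w : w != (0, 0, 0) -> flip w != (0, 0, 0).
Proof.
by apply: contra => /eqP h; rewrite -(flipK w) h.
Qed.
Lemma iter_unit_surj n w : exists w', iter n unit_mul w' = w.
Proof.
elim: n w => [|n IHn] w; first by exists w.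
by have [w' w'E] := IHn (unit_div w); exists w'; rewrite iterS w'E unit_divK.
Qed.

Section Embeddings.
Variable R : realType.

Definition theta : R := 2 `^ 3^-1.
Lemma theta_gt0 : 0 < theta. Proof. by rewrite powR_gt0. Qed.
Lemma theta3 : theta ^+ 3 = 2.
Proof. by rewrite -powR_mulrn ?ltW ?theta_gt0// -powRrM mulVf// powRr1. Qed.
Lemma theta_gt1 : 1 < theta.
Proof. have := theta3; have := theta_gt0; rewrite !exprS expr0; nra. Qed.
Lemma theta_lt2 : theta < 2.
Proof. have := theta3; have := theta_gt0; rewrite !exprS expr0; nra. Qed.

Local Notation sqrt3 := (Num.sqrt (3 : R)).
Lemma sqrt3_sqr : sqrt3 ^+ 2 = 3. Proof. by rewrite sqr_sqrtr. Qed.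
Lemma sqrt3_gt0 : 0 < sqrt3. Proof. by rewrite sqrtr_gt0. Qed.

(** The real embedding, and the complex embedding multiplied by the cube root of
    unity that makes [flip] act diagonally on it. *)
Definition psi (w : Z3) : R :=
  let: (a, b, c) := w in a%:~R + b%:~R * theta + c%:~R * theta ^+ 2.
Definition zeta_re (w : Z3) : R :=
  let: (a, b, c) := w in c%:~R * theta ^+ 2 - (a%:~R + b%:~R * theta) / 2.
Definition zeta_im (w : Z3) : R :=
  let: (a, b, c) := w in sqrt3 / 2 * (a%:~R - b%:~R * theta).
Definition hypot (x y : R) := Num.sqrt (x ^+ 2 + y ^+ 2).
Definition zeta_abs w := hypot (zeta_re w) (zeta_im w).

Lemma hypot_sqr x y : hypot x y ^+ 2 = x ^+ 2 + y ^+ 2.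
Proof. by rewrite sqr_sqrtr// addr_ge0// sqr_ge0. Qed.
Lemma hypot_ge0 x y : 0 <= hypot x y. Proof. exact: sqrtr_ge0. Qed.
Lemma zeta_abs_ge0 w : 0 <= zeta_abs w. Proof. exact: sqrtr_ge0. Qed.
Lemma hypot_ge_re x y : `|x| <= hypot x y.
Proof. by rewrite -sqrtr_sqr ler_sqrt ?addr_ge0 ?sqr_ge0// lerDl sqr_ge0. Qed.
Lemma hypot_ge_im x y : `|y| <= hypot x y.
Proof. by rewrite -sqrtr_sqr ler_sqrt ?addr_ge0 ?sqr_ge0// lerDr sqr_ge0. Qed.
Lemma hypot_le x y c : 0 <= c -> x ^+ 2 + y ^+ 2 <= c ^+ 2 -> hypot x y <= c.
Proof. by move=> c0 h; rewrite -(ger0_norm c0) -sqrtr_sqr ler_wsqrtr. Qed.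

Lemma psi_zeta_norm w : psi w * zeta_abs w ^+ 2 = (cubic_norm w)%:~R.
Proof.
case: w => [[a b] c]; rewrite /zeta_abs hypot_sqr /psi /zeta_re /zeta_im /cubic_norm.
rewrite exprMn expr_div_n sqrt3_sqr.
move: theta theta3 => t t3.
transitivity (a%:~R ^+ 3 + t ^+ 3 * b%:~R ^+ 3 + (t ^+ 3) ^+ 2 * c%:~R ^+ 3
              - 3 * t ^+ 3 * (a%:~R * b%:~R * c%:~R)); first by field.
by rewrite t3; ring.
Qed.

(** A nonzero integer has absolute value at least 1. *)
Lemma psi_zeta_ge1 w : w != (0, 0, 0) -> 1 <= `|psi w| * zeta_abs w ^+ 2.
Proof.
move=> w0; rewrite -[X in _ * X]ger0_norm ?sqr_ge0// -normrM psi_zeta_norm.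
rewrite -intr_norm -[leLHS](mulr1z) ler_int.
have : cubic_norm w != 0 by apply: contra w0 => /eqP /cubic_norm_eq0 ->.
by lia.
Qed.

Lemma psi_flip w : psi (flip w) = (psi w - 4 * zeta_re w) / 3.
Proof. case: w => [[a b] c] /=; by field. Qed.
Lemma zeta_re_flip w : zeta_re (flip w) = - (zeta_re w + 2 * psi w) / 3.
Proof. case: w => [[a b] c] /=; by field. Qed.
Lemma zeta_im_flip w : zeta_im (flip w) = zeta_im w.
Proof. by case: w => [[a b] c] /=. Qed.

(** [lam] is the real embedding of the unit; its complex embedding has modulus
    [sigma] and argument given by [unit_cos] and [unit_sin], since the norm of
    the unit is 1. *)
Definition lam : R := 1 + theta + theta ^+ 2.
Definition sigma : R := Num.sqrt lam^-1.
Definition unit_cos : R := (1 - (theta + theta ^+ 2) / 2) / sigma.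
Definition unit_sin : R := (sqrt3 / 2 * (theta - theta ^+ 2)) / sigma.

Lemma lam_gt0 : 0 < lam.
Proof. by rewrite /lam !addr_gt0// ?exprn_gt0// theta_gt0. Qed.
Lemma sigma_gt0 : 0 < sigma.
Proof. by rewrite sqrtr_gt0 invr_gt0 lam_gt0. Qed.
Lemma sigma2 : sigma ^+ 2 = lam^-1.
Proof. by rewrite sqr_sqrtr// invr_ge0 ltW// lam_gt0. Qed.
Lemma lamE : lam = sigma ^- 2.
Proof. by rewrite sigma2 invrK. Qed.
Lemma sigma_lt1 : sigma < 1.
Proof.
rewrite -sqrtr1 ltr_sqrt// invf_lt1 ?lam_gt0// /lam.
by have := theta_gt1; have := theta_gt0; nra.
Qed.

Lemma sigma_unit_cos : sigma * unit_cos = 1 - (theta + theta ^+ 2) / 2.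
Proof. by rewrite mulrC divfK// gt_eqF// sigma_gt0. Qed.
Lemma sigma_unit_sin : sigma * unit_sin = sqrt3 / 2 * (theta - theta ^+ 2).
Proof. by rewrite mulrC divfK// gt_eqF// sigma_gt0. Qed.

Lemma unit_cos_sin : unit_cos ^+ 2 + unit_sin ^+ 2 = 1.
Proof.
rewrite /unit_cos /unit_sin !expr_div_n -mulrDl exprMn expr_div_n sqrt3_sqr sigma2 invrK.
have -> : lam = 1 + theta + theta ^+ 2 by [].
move: theta theta3 => t t3.
transitivity ((t ^+ 3 - 1)^+ 2); first by field.
by rewrite t3; ring.
Qed.

(** Cosine and sine of n times the argument of the unit. *)
Fixpoint rotn n : R * R :=
  if n is n'.+1 then
    (unit_cos * (rotn n').1 - unit_sin * (rotn n').2, unit_sin * (rotn n').1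
      + unit_cos * (rotn n').2)
  else (1, 0).

Lemma rotn_unit n : (rotn n).1 ^+ 2 + (rotn n).2 ^+ 2 = 1.
Proof.
elim: n => [|n IHn] /=; first by ring.
rewrite -[RHS]mul1r -{1}IHn -unit_cos_sin; ring.
Qed.

Lemma psi_unit w : psi (unit_mul w) = lam * psi w.
Proof.
case: w => [[a b] c] /=; rewrite /lam.
move: theta theta3 => t t3.
apply/eqP; rewrite -subr_eq0; apply/eqP.
transitivity ((t ^+ 3 - 2) * - (b%:~R + c%:~R + c%:~R * t)); first by ring.
by rewrite t3; ring.
Qed.
Lemma zeta_re_unit w : zeta_re (unit_mul w) = sigma * (unit_cos * zeta_re w
  - unit_sin * zeta_im w).
Proof.
rewrite mulrBr (mulrA sigma unit_cos) (mulrA sigma unit_sin) sigma_unit_cos sigma_unit_sin.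
case: w => [[a b] c] /=.
move: theta theta3 sqrt3 sqrt3_sqr => t t3 s s3.
apply/eqP; rewrite -subr_eq0; apply/eqP.
transitivity ((t ^+ 3 - 2) * (c%:~R + t * c%:~R + b%:~R) / 2 + (s ^+ 2 - 3) * (t
  - t ^+ 2) * (a%:~R - b%:~R * t) / 4); first by field.
by rewrite t3 s3; ring.
Qed.
Lemma zeta_im_unit w : zeta_im (unit_mul w) = sigma * (unit_sin * zeta_re w
  + unit_cos * zeta_im w).
Proof.
rewrite mulrDr (mulrA sigma unit_sin) (mulrA sigma unit_cos) sigma_unit_cos sigma_unit_sin.
case: w => [[a b] c] /=.
move: theta theta3 sqrt3 => t t3 s.
apply/eqP; rewrite -subr_eq0; apply/eqP.
transitivity ((t ^+ 3 - 2) * s / 2 * (c%:~R * t - b%:~R - c%:~R)); first by field.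
by rewrite t3; ring.
Qed.

Lemma psi_iter n w : psi (iter n unit_mul w) = sigma ^- n ^+ 2 * psi w.
Proof.
elim: n => [|n IHn]; first by rewrite expr0 invr1 expr1n mul1r.
rewrite iterS psi_unit IHn mulrA lamE; congr (_ * _).
by rewrite -!exprVn -!exprM mulSn exprD.
Qed.
Lemma zeta_iter n w :
  zeta_re (iter n unit_mul w) = sigma ^+ n * ((rotn n).1 * zeta_re w
    - (rotn n).2 * zeta_im w) /\
  zeta_im (iter n unit_mul w) = sigma ^+ n * ((rotn n).2 * zeta_re w
    + (rotn n).1 * zeta_im w).
Proof.
elim: n => [|n [IHx IHy]] /=; first by split; ring.
by rewrite zeta_re_unit zeta_im_unit IHx IHy exprS; split; ring.
Qed.

Lemma zeta_abs_iter n w : zeta_abs (iter n unit_mul w) = sigma ^+ n * zeta_abs w.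
Proof.
have [hx hy] := zeta_iter n w.
have s0 : 0 <= sigma ^+ n by rewrite exprn_ge0// ltW// sigma_gt0.
apply/eqP; rewrite -(eqrXn2 (n:=2))// ?zeta_abs_ge0// ?mulr_ge0// ?zeta_abs_ge0//;
  apply/eqP.
rewrite exprMn !hypot_sqr hx hy.
transitivity (sigma ^+ n ^+ 2 * (((rotn n).1^+2 + (rotn n).2^+2) * (zeta_re w^+2
  + zeta_im w^+2))); first by ring.
by rewrite rotn_unit mul1r.
Qed.

(** Proportional to [psi] before a flip.  After a long power of the unit every
    linear form is nearly a multiple of [psi], so this is what the denominator
    of M_k w looks like when M_k ends in a flip. *)
Definition past_limit (w : Z3) : R := `|psi w - 4 * zeta_re w|.
Lemma past_limitE w : past_limit w = 3 * `|psi (flip w)|.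
Proof. by rewrite psi_flip normrM normfV (ger0_norm (_ : 0 <= 3))// /past_limit;
  by field. Qed.

Lemma zeta_abs_flip_le w : zeta_abs (flip w) <= zeta_abs w + `|psi w|.
Proof.
have z0 := zeta_abs_ge0 w.
apply: hypot_le; first by rewrite addr_ge0 ?normr_ge0.
rewrite zeta_re_flip zeta_im_flip.
have := hypot_sqr (zeta_re w) (zeta_im w); rewrite -/(zeta_abs w) => zs.
have p2 : psi w ^+ 2 = `|psi w| ^+ 2 by rewrite real_normK// num_real.
rewrite sqrrD zs -p2.
have zp0 : 0 <= zeta_abs w * `|psi w| by rewrite mulr_ge0 ?normr_ge0.
have := sqr_ge0 (zeta_re w); have := sqr_ge0 (psi w).
have := sqr_ge0 (zeta_re w - psi w); rewrite p2 -/(zeta_abs w) in zp0 *.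
lra.
Qed.

(** If |zeta (flip w)| is comparable with |zeta w|, this is the bound for the
    norm of flip w; otherwise psi dominates zeta at w, so that psi (flip w) is
    comparable with psi w, and it is the bound for the norm of w. *)
Lemma past_limit_zeta w : w != (0, 0, 0) -> 3 / 49 <= past_limit w * zeta_abs w ^+ 2.
Proof.
move=> w0.
have h1 := psi_zeta_ge1 w0; have h2 := psi_zeta_ge1 (flip_neq0 w0).
have X_le := hypot_ge_re (zeta_re w) (zeta_im w); rewrite -/(zeta_abs w) in X_le.
have z0 := zeta_abs_ge0 w; have z'0 := zeta_abs_ge0 (flip w).
have g0 : 0 <= past_limit w by exact: normr_ge0.
rewrite past_limitE in g0 *.
have [le7|lt7] := leP (zeta_abs (flip w)) (7 * zeta_abs w).
  have : `|psi (flip w)| * zeta_abs (flip w) ^+ 2 <=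
    `|psi (flip w)| * (49 * zeta_abs w ^+ 2).
    apply: ler_wpM2l => //; nra.
  by nra.
have zf := zeta_abs_flip_le w.
have psif : `|psi (flip w)| >= `|psi w| / 9.
  rewrite psi_flip normrM normfV (ger0_norm (_ : 0 <= 3))//.
  have := lerB_dist (psi w) (4 * zeta_re w); rewrite normrM (ger0_norm (_ : 0 <= 4))//.
  lra.
have : `|psi w| / 9 * zeta_abs w ^+ 2 <= `|psi (flip w)| * zeta_abs w ^+ 2.
  by rewrite ler_wpM2r// sqr_ge0.
lra.
Qed.

End Embeddings.

(** * Irrational rotations *)

(** Pigeonhole on the fractional parts of phi n / T, in boxes of length < d / T. *)
Lemma multiples_return (R : realType) (phi T d : R) : 0 < T -> 0 < d ->
  exists m l, (0 < m)%N /\ `|phi *+ m - T *~ l| < d.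
Proof.
move=> T0 d0; pose K := (Num.truncn (T / d)).+1.
have K0 : 0 < K%:R :> R by rewrite ltr0n.
have TK : T / K%:R < d.
  by rewrite ltr_pdivrMr// mulrC -ltr_pdivrMr// truncnS_gt.
pose l n := Num.floor (phi *+ n / T); pose r n := phi *+ n / T - (l n)%:~R.
have r_itv n : 0 <= r n < 1.
  have := floor_le (phi *+ n / T); have := floorD1_gt (phi *+ n / T).
  by rewrite intrD /r /l; lra.
have box_lt n : (Num.truncn (K%:R * r n) < K)%N.
  have /andP[r0 r1] := r_itv n.
  have Kr0 : 0 <= K%:R * r n by rewrite mulr_ge0// ltW.
  rewrite -(ltr_nat R); apply: le_lt_trans (_ : K%:R * r n < _).
    by rewrite truncn_le.
  by rewrite gtr_pMr.
pose f (i : 'I_K.+1) : 'I_K := Ordinal (box_lt i).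
have /injectivePn[i [j neq_ij eq_f]] : ~~ injectiveb f.
  apply/negP => /injectiveP /leq_card; rewrite !card_ord; lia.
wlog lt_ij : i j neq_ij eq_f / (i < j)%N.
  move=> wl; have := neq_ij; rewrite neq_ltn => /orP[] lt; first exact: wl lt.
  by apply: wl lt => //; rewrite eq_sym.
exists (j - i)%N, (l j - l i); split; first by rewrite subn_gt0.
apply: le_lt_trans TK; rewrite ler_pdivlMr//.
have -> : phi *+ (j - i) - T *~ (l j - l i) = T * (r j - r i).
  rewrite /r mulrnBr ?(ltnW lt_ij)// mulrzBr -!(mulrzr T) .
  by field; rewrite gt_eqF.
rewrite normrM (gtr0_norm T0) -mulrA ger_pMr//.
have /andP[ri0 ri1] := r_itv i; have /andP[rj0 rj1] := r_itv j.
have := congr1 val eq_f => /= /(congr1 (fun n => n%:R : R)) tr_eq.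
have /truncn_itv/andP[i1 i2] : 0 <= K%:R * r i by rewrite mulr_ge0// ltW.
have /truncn_itv/andP[j1 j2] : 0 <= K%:R * r j by rewrite mulr_ge0// ltW.
rewrite -natr1 in i2; rewrite -natr1 in j2.
rewrite -[X in _ * X](gtr0_norm K0) -normrM mulrBl !(mulrC _ K%:R) ler_norml.
by apply/andP; split; lra.
Qed.

(** A small nonzero return g exists; its multiples, added to n0 phi, come within
    |g| of any target modulo T.  The integer L puts the target on the side of
    n0 phi to which g points. *)
Lemma dense_multiples (R : realType) (phi T b d : R) n0 : 0 < T -> 0 < d ->
  (forall m l, (0 < m)%N -> phi *+ m != T *~ l) ->
  exists n l, (n0 <= n)%N /\ `|phi *+ n - T *~ l - b| < d.
Proof.
move=> T0 d0 irr; have [m [l [m0]]] := multiples_return phi T0 d0.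
set g := _ - _ => g_lt.
have g0 : g != 0 by rewrite subr_eq0 irr.
pose c := b - phi *+ n0.
have [L L0] : exists L : int, 0 <= (c + T *~ L) / g.
  case: (ltgtP 0 g) => [gp|gn|ge]; last by rewrite -ge eqxx in g0.
    exists (Num.floor (- c / T) + 1); rewrite divr_ge0 ?(ltW gp)//.
    have := ltW (floorD1_gt (- c / T)); rewrite ler_pdivrMr// mulrzl; lra.
  exists (Num.floor (- c / T)); rewrite -mulrNN mulr_ge0//; last first.
    by rewrite oppr_ge0 invr_le0 ltW.
  by have := floor_le (- c / T); rewrite ler_pdivlMr// mulrzl; lra.
pose j := Num.truncn ((c + T *~ L) / g).
have /truncn_itv/andP[j1 j2] := L0; rewrite -natr1 -/j in j1 j2.
exists (n0 + m * j)%N, (l *+ j + L); split; first by rewrite leq_addr.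
have -> : phi *+ (n0 + m * j) - T *~ (l *+ j + L) - b =
          g * (j%:R - (c + T *~ L) / g).
  have Tlj : T *~ (l *+ j) = T *~ l *+ j.
    by rewrite -(mulr_natr l j) natz mulrzA -pmulrn.
  rewrite mulrBr (mulrCA g) mulfV// mulr1 /c mulrnDr mulrnA mulrzDr Tlj.
  rewrite mulr_natr /g mulrnBl.
  move: (phi *+ n0) (phi *+ m *+ j) (T *~ l *+ j) (T *~ L) => u1 u2 u3 u4.
  ring.
apply: le_lt_trans g_lt; rewrite normrM ler_piMr//.
by rewrite ler_norml; apply/andP; split; lra.
Qed.

Lemma unit_circle_angle (R : realType) (x y : R) : x ^+ 2 + y ^+ 2 = 1 ->
  exists a, cos a = x /\ sin a = y.
Proof.
move=> xy1.
have y2 : y ^+ 2 = 1 - x ^+ 2 by rewrite -xy1; ring.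
have x_itv : -1 <= x <= 1.
  rewrite -ler_norml -(ler_pXn2r (n:=2))// ?nnegrE// expr1n real_normK ?num_real//.
  by rewrite -xy1 lerDl sqr_ge0.
have [y0|y0] := leP 0 y.
  exists (acos x); split; first by rewrite acosK.
  by rewrite sin_acos// -y2 sqrtr_sqr ger0_norm.
exists (- acos x); split; first by rewrite cosN acosK.
by rewrite sinN sin_acos// -y2 sqrtr_sqr ltr0_norm// opprK.
Qed.

Lemma cos_sin_period (R : realType) (x : R) (l : int) :
  cos (x - (pi *+ 2) *~ l) = cos x /\ sin (x - (pi *+ 2) *~ l) = sin x.
Proof.
have pc n y : cos (y + pi *+ 2 *+ n) = cos y := periodicn (@cosD2pi R) n y.
have ps n y : sin (y + pi *+ 2 *+ n) = sin y := periodicn (@sinD2pi R) n y.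
case: l => n; rewrite ?NegzE ?mulrNz ?opprK -pmulrn ?pc ?ps//.
by rewrite -{2 4}(subrK (pi *+ 2 *+ n) x) pc ps.
Qed.

Section Density.
Variable R : realType.

(** If the complex embedding of u^n were real, then u^n t^2 would have b t = a, so
    a = b = 0; but its coefficient b is positive. *)
Lemma rotn_neq0 n : (0 < n)%N -> (@rotn R n).2 != 0.
Proof.
move=> n0; apply/eqP => rot0.
pose w : Z3 := (0, 0, 1).
have [_ ] := zeta_iter R n w; rewrite rot0 mul0r add0r.
rewrite {2}/zeta_im /w /= !mul0r subr0 !mulr0.
have : exists a b c, iter n unit_mul w = (a, b, c) /\ (0 <= a) && (0 < b) && (0 <= c).
  case: n n0 {rot0} => // n _.
  elim: n => [|n [a [b [c [IHn abc]]]]].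
    by exists 2, 2, 1.
  rewrite iterS IHn /=; do 3!eexists; split; first by reflexivity.
  by move: abc; lia.
move=> [a [b [c [-> /andP[/andP[a0 b0] c0]]]]] /= /eqP.
rewrite mulf_eq0 gt_eqF/= ?divr_gt0 ?sqrt3_gt0// => /eqP ab.
have /eqP := @psi_zeta_norm R (a, - b, 0).
rewrite {1}/psi mul0r addr0 rmorphN mulNr ab mul0r eq_sym intr_eq0.
by move=> /eqP /cubic_norm_eq0 [_ b00]; move: b0; rewrite -oppr_lt0 b00.
Qed.

Lemma rotn_dense (c s d : R) n0 : c ^+ 2 + s ^+ 2 = 1 -> 0 < d ->
  exists n, [/\ (n0 <= n)%N, `|(rotn R n).1 - c| <= d & `|(rotn R n).2 - s| <= d].
Proof.
move=> cs1 d0.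
have [phi [phic phis]] := unit_circle_angle (unit_cos_sin R).
have rotnE n : rotn R n = (cos (phi *+ n), sin (phi *+ n)).
  elim: n => [|n IHn]; first by rewrite mulr0n cos0 sin0.
  by rewrite /= IHn mulrS cosD sinD phic phis.
have [b [bc bs]] := unit_circle_angle cs1.
have T0 : 0 < (pi *+ 2 : R) by rewrite mulrn_wgt0// pi_gt0.
have irr m (l : int) : (0 < m)%N -> phi *+ m != (pi *+ 2) *~ l.
  move=> m0; apply/eqP => phim; have := rotn_neq0 m0.
  rewrite rotnE /= -(cos_sin_period _ l).2 phim subrr sin0 eqxx //.
have : \forall t \near b, `|cos t - c| <= d /\ `|sin t - s| <= d.
  have /(@cvgrPdist_le _ _ _ (nbhs b))/(_ _ d0) h1 := @continuous_cos R b.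
  have /(@cvgrPdist_le _ _ _ (nbhs b))/(_ _ d0) h2 := @continuous_sin R b.
  near=> t; split; rewrite distrC -?bc -?bs; near: t; [exact: h1|exact: h2].
move=> /nbhs_ballP [e e0 be].
have [n [l [n0n near_b]]] := dense_multiples b n0 T0 e0 irr.
exists n; rewrite n0n rotnE /=.
have [<- <-] := cos_sin_period (phi *+ n) l.
have [] : `|cos (phi *+ n - pi *+ 2 *~ l) - c| <= d /\ `|sin (phi *+ n - pi *+ 2 *~ l)
  - s| <= d.
  by apply: be; rewrite -ball_normE /= distrC.
by [].
Unshelve. all: by end_near.
Qed.
End Density.

(** * Coordinates adapted to a product of matrices *)

Section Frames.
Variable R : realType.
Local Notation V := 'rV[R]_2.
Local Notation psi := (@psi R).
Local Notation zeta_re := (@zeta_re R).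
Local Notation zeta_im := (@zeta_im R).
Local Notation sigma := (sigma R).
Local Notation zeta_abs := (@zeta_abs R).
Local Notation past_limit := (@past_limit R).
Local Notation eps n := (sigma ^+ n ^+ 3).
Local Notation rotn := (rotn R).

Definition comb (v : V * V) (x y : R) : V := x *: v.1 + y *: v.2.
Definition rotate (q : R * R) (v : V * V) : V * V :=
  (q.1 *: v.1 + q.2 *: v.2, - q.2 *: v.1 + q.1 *: v.2).

Definition zden (w : Z3) : R := let: (_, _, c) := w in c%:~R.
Definition znum (w : Z3) : V :=
  let: (a, b, _) := w in a%:~R *: delta_mx 0 0 + b%:~R *: delta_mx 0 1.

(** The data that describe a product M of units and flips:
    q (M w) = fscale^2 (psi w + fpast1 zeta_re w + fpast2 zeta_im w), the point
    [fpoint] is the image under M of the axis zeta = 0, and [fbasis] lists the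
    images of the two basis vectors under the linear map A for which
    p (M w) - q (M w) fpoint = A (zeta w) / fscale.  The powers of fscale are
    those for which |det A| does not depend on M. *)
Record frame := Frame {fscale : R; fpast1 : R; fpast2 : R; fpoint : V; fbasis : V * V}.

Definition past (f : frame) (w : Z3) : R := psi w + fpast1 f * zeta_re w
  + fpast2 f * zeta_im w.

Definition frame_of (M : Z3 -> Z3) (f : frame) := forall w,
  zden (M w) = fscale f ^+ 2 * past f w /\
  znum (M w) = zden (M w) *: fpoint f + (fscale f)^-1 *: comb (fbasis f) (zeta_re w)
    (zeta_im w).

(** The linear form of the frame, turned by the rotation of u^n. *)
Definition step_a1 n f := fpast1 f * (rotn n).1 + fpast2 f * (rotn n).2.
Definition step_a2 n f := fpast2 f * (rotn n).1 - fpast1 f * (rotn n).2.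
Definition step_den n f := 1 - 2 * (sigma ^+ n ^+ 3 * step_a1 n f).
Definition step_scale n f := Num.sqrt (step_den n f / 3).

(** The frame of M u^n flip, from that of M; obtained by substituting the action
    of the unit and of flip on (psi, zeta), and by absorbing the multiples of
    psi that appear into the new base point. *)
Definition step n (f : frame) : frame :=
  let r := rotate (rotn n) (fbasis f) in
  let y' := fscale f / sigma ^+ n * step_scale n f in
  let t1' := - (4 + sigma ^+ n ^+ 3 * step_a1 n f) / step_den n f in
  let t2' := 3 * sigma ^+ n ^+ 3 * step_a2 n f / step_den n f in
  Frame y' t1' t2'
    (fpoint f - (2 / 3 * sigma ^+ n / (fscale f * y' ^+ 2)) *: r.1)
    ((step_scale n f * (2 * t1' - 1) / 3) *: r.1,
     step_scale n f *: (r.2 + (2 / 3 * t2') *: r.1)).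

Definition step_map n (M : Z3 -> Z3) : Z3 -> Z3 :=
  fun w => M (iter n unit_mul (flip w)).

Lemma sigman_gt0 n : 0 < sigma ^+ n.
Proof. by rewrite exprn_gt0// sigma_gt0. Qed.

Lemma step_scale_sqr n f : 0 < step_den n f ->
  step_scale n f ^+ 2 = step_den n f / 3.
Proof. by move=> d0; rewrite sqr_sqrtr// ltW// divr_gt0. Qed.

Lemma step_past n f w : 0 < step_den n f ->
  past f (iter n unit_mul (flip w)) =
    (sigma ^+ n) ^- 2 * (step_den n f / 3) * past (step n f) w.
Proof.
move=> d0; have [hx hy] := zeta_iter R n (flip w).
rewrite /past psi_iter hx hy psi_flip zeta_re_flip zeta_im_flip /=.
have := sigman_gt0 n; move: d0; rewrite /step_den /step_a1 /step_a2.
move: (sigma ^+ n) (psi w) (zeta_re w) (zeta_im w) (fpast1 f) (fpast2 f) (rotn n).1 (rotn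
  n).2.
move=> t p x y t1 t2 c s d0 t0.
by field; rewrite !gt_eqF.
Qed.

Lemma step_frame_of n f M : 0 < fscale f -> 0 < step_den n f -> frame_of M f ->
  frame_of (step_map n M) (step n f).
Proof.
move=> y0 d0 Mf w; rewrite /step_map.
have [Hq Hp] := Mf (iter n unit_mul (flip w)).
have s0 := sigman_gt0 n.
have sc2 := step_scale_sqr d0.
have sc0 : step_scale n f != 0.
  apply/eqP => sc0; move: sc2; rewrite sc0 expr0n /= => /eqP.
  by rewrite eq_sym gt_eqF// divr_gt0.
have Hq' : zden (M (iter n unit_mul (flip w))) =
    fscale (step n f) ^+ 2 * past (step n f) w.
  rewrite Hq step_past// /= !exprMn sc2 exprVn; ring.
split=> //.
rewrite Hp.
have [hx hy] := zeta_iter R n (flip w).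
rewrite /comb hx hy zeta_re_flip zeta_im_flip.
have y'0 : fscale (step n f) != 0.
  rewrite /=; apply: mulf_neq0 => //.
  by apply: mulf_neq0; rewrite ?invr_eq0 gt_eqF.
rewrite [in RHS]Hq' {1}Hq'.
have y'E : fscale (step n f) = fscale f / sigma ^+ n * step_scale n f by [].
have [sf y2] : step_scale n f = fscale (step n f) * sigma ^+ n / fscale f /\ fscale f != 0.
  by rewrite y'E gt_eqF//; split=> //; field; rewrite !gt_eqF.
rewrite {y'E Hq' Hq Hp sc2}.
rewrite /past.
have -> : fpoint (step n f) = fpoint f - (2 / 3 * sigma ^+ n / (fscale f * fscale (step n
  f) ^+ 2)) *: (rotate (rotn n) (fbasis f)).1 by [].
have -> : fbasis (step n f) = ((step_scale n f * (2 * fpast1 (step n f)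
  - 1) / 3) *: (rotate (rotn n) (fbasis f)).1,
  step_scale n f *: ((rotate (rotn n) (fbasis f)).2
    + (2 / 3 * fpast2 (step n f)) *: (rotate (rotn n) (fbasis f)).1)) by [].
rewrite sf /rotate /=.
move: (fscale (step n f)) (fpast1 (step n f)) (fpast2 (step n f)) y'0 => y' t1' t2' y'0.
apply/rowP => j; rewrite !mxE.
move: (sigma ^+ n) s0 => t t0.
by field; rewrite sc0 !gt_eqF.
Qed.

Lemma step_map_surj (n : nat) (M : Z3 -> Z3) : (forall w, exists w', M w' = w) ->
  forall w, exists w', step_map n M w' = w.
Proof.
move=> sM w; have [w1 w1E] := sM w; have [w2 w2E] := iter_unit_surj n w1.
by exists (flip w2); rewrite /step_map flipK w2E.
Qed.

Variable N : V -> R.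
Hypothesis normN : is_norm N.

(** A frame enters the estimates only through the norm u -> N (A u) on the plane
    of zeta. *)
Definition frame_norm (v : V * V) x y := N (comb v x y).
Definition basis_size (v : V * V) := N v.1 + N v.2.
Definition basis_dist (v v' : V * V) := N (v.1 - v'.1) + N (v.2 - v'.2).

Lemma N_scale a x : N (a *: x) = `|a| * N x. Proof. exact: is_norm_scale. Qed.
Lemma N_triangle x y : N (x + y) <= N x + N y. Proof. exact: is_norm_triangle. Qed.
Lemma N_ge0 x : 0 <= N x. Proof. exact: is_norm_ge0. Qed.
Lemma N_opp x : N (- x) = N x. Proof. exact: is_normN. Qed.
Lemma basis_size_ge0 v : 0 <= basis_size v. Proof. by rewrite addr_ge0 ?N_ge0. Qed.
Lemma basis_dist_ge0 v v' : 0 <= basis_dist v v'. Proof. by rewrite addr_ge0 ?N_ge0. Qed.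
Lemma frame_norm_ge0 v x y : 0 <= frame_norm v x y. Proof. exact: N_ge0. Qed.

Lemma frame_norm_size v x y : frame_norm v x y <= basis_size v * hypot x y.
Proof.
rewrite /frame_norm /comb; apply: le_trans (N_triangle _ _) _;
  rewrite !N_scale /basis_size mulrDl.
by rewrite ![_ * hypot _ _]mulrC lerD// ler_wpM2r ?N_ge0 ?hypot_ge_re ?hypot_ge_im.
Qed.

Lemma frame_norm_dist v v' x y : frame_norm v x y <= frame_norm v' x y
  + basis_dist v v' * hypot x y.
Proof.
have -> : basis_dist v v' = basis_size (v.1 - v'.1, v.2 - v'.2) by [].
apply: le_trans (lerD (lexx _) (frame_norm_size _ _ _)).
apply: le_trans (N_triangle _ _); rewrite le_eqVlt; apply/orP; left; apply/eqP.
by congr N; rewrite /comb /= !scalerBr; move: (x *: v.1) (x *: v'.1) (y *: v.2) (y *: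
  v'.2) => a b c d; apply/rowP => j; rewrite !mxE; ring.
Qed.

Lemma basis_distC v v' : basis_dist v v' = basis_dist v' v.
Proof. by rewrite /basis_dist -N_opp opprB -(N_opp (v.2 - _)) opprB. Qed.

Lemma unit_le1 (c s : R) : c ^+ 2 + s ^+ 2 = 1 -> `|c| <= 1 /\ `|s| <= 1.
Proof.
move=> cs; have h := hypot_ge_re c s; have h' := hypot_ge_im c s.
by rewrite /hypot cs sqrtr1 in h h'.
Qed.

Lemma frame_norm_rotate q v x y : frame_norm (rotate q v) x y = frame_norm v (q.1 * x
  - q.2 * y) (q.2 * x + q.1 * y).
Proof.
congr N; rewrite /comb /rotate /=; apply/rowP => j; rewrite !mxE; ring.
Qed.

Lemma N_rot1 q v : q.1 ^+ 2 + q.2 ^+ 2 = 1 -> N (rotate q v).1 <= basis_size v.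
Proof.
move=> /unit_le1[c1 s1]; apply: le_trans (N_triangle _ _) _; rewrite !N_scale.
by rewrite lerD// -[leRHS]mul1r ler_wpM2r ?N_ge0.
Qed.
Lemma N_rot2 q v : q.1 ^+ 2 + q.2 ^+ 2 = 1 -> N (rotate q v).2 <= basis_size v.
Proof.
move=> /unit_le1[c1 s1]; apply: le_trans (N_triangle _ _) _; rewrite !N_scale normrN.
by rewrite lerD// -[leRHS]mul1r ler_wpM2r ?N_ge0.
Qed.

Local Notation sqrt3 := (Num.sqrt (3 : R)).
(** The effect of a step on the basis when n is infinitely large: rotate, then
    apply h = diag (-sqrt 3, 1 / sqrt 3). *)
Definition limit_step (q : R * R) (v : V * V) : V * V :=
  (- sqrt3 *: (rotate q v).1, sqrt3^-1 *: (rotate q v).2).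

Lemma sqrt3_bounds : 17 / 10 < sqrt3 /\ sqrt3 < 18 / 10 :> R.
Proof. have := sqrt3_sqr R; have := sqrt3_gt0 R; rewrite expr2; split; nra. Qed.

Definition frame_ok f := [/\ 0 < fscale f, `|fpast1 f| <= 5 & `|fpast2 f| <= 5].

Lemma step_a_bounds n f : frame_ok f -> `|step_a1 n f| <= 10 /\ `|step_a2 n f| <= 10.
Proof.
case=> _ h1 h2; have [c1 s1] := unit_le1 (rotn_unit R n).
rewrite /step_a1 /step_a2; split.
  apply: le_trans (ler_normD _ _) _; rewrite !normrM.
  have : `|fpast1 f| * `|(rotn n).1| <= 5 * 1 by rewrite ler_pM.
  have : `|fpast2 f| * `|(rotn n).2| <= 5 * 1 by rewrite ler_pM.
  lra.
apply: le_trans (ler_normB _ _) _; rewrite !normrM.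
have : `|fpast2 f| * `|(rotn n).1| <= 5 * 1 by rewrite ler_pM.
have : `|fpast1 f| * `|(rotn n).2| <= 5 * 1 by rewrite ler_pM.
lra.
Qed.

(** All corrections in a step are of order eps n, the ratio between the
    contraction of zeta and the dilation of psi by u^n. *)
Lemma step_den_bounds n f : frame_ok f -> sigma ^+ n <= 1 / 10 ->
  [/\ 98 / 100 <= step_den n f <= 102 / 100,
      `|sigma ^+ n ^+ 3 * step_a1 n f| <= 10 * sigma ^+ n ^+ 3 &
      `|step_den n f - 1| <= 20 * sigma ^+ n ^+ 3].
Proof.
move=> fo sn; have [h1 h2] := step_a_bounds n fo.
have s0 := sigman_gt0 n.
have t0 : 0 < sigma ^+ n ^+ 3 by rewrite exprn_gt0.
have t1 : sigma ^+ n ^+ 3 <= 1 / 1000.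
  have -> : 1 / 1000 = (1 / 10) ^+ 3 :> R by field.
  by rewrite lerXn2r ?nnegrE ?(ltW s0).
have e1 : `|sigma ^+ n ^+ 3 * step_a1 n f| <= 10 * sigma ^+ n ^+ 3.
  by rewrite normrM (gtr0_norm t0) mulrC ler_wpM2r ?(ltW t0).
have /ler_normlP[e2 e3] := e1.
rewrite /step_den; split=> //; first by apply/andP; split; lra.
by rewrite ler_norml; apply/andP; split; lra.
Qed.

(** The linear form forgets its past: psi is dilated and zeta contracted, so that
    only the image of psi under flip, psi - 4 zeta_re up to a factor, survives. *)
Lemma step_fpast_bounds n f : frame_ok f -> sigma ^+ n <= 1 / 10 ->
  `|fpast1 (step n f) + 4| <= 100 * sigma ^+ n ^+ 3 /\
  `|fpast2 (step n f)| <= 100 * sigma ^+ n ^+ 3.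
Proof.
move=> fo sn; have [/andP[d1 d2] e1 _] := step_den_bounds fo sn.
have [_ h2] := step_a_bounds n fo.
have s0 := sigman_gt0 n.
have t0 : 0 < sigma ^+ n ^+ 3 by rewrite exprn_gt0.
have dp : 0 < step_den n f by lra.
split=> /=.
  have -> : - (4 + sigma ^+ n ^+ 3 * step_a1 n f) / step_den n f + 4 =
    - 9 * (sigma ^+ n ^+ 3 * step_a1 n f) / step_den n f.
    have := erefl (step_den n f); rewrite {2}/step_den => dE.
    have -> : sigma ^+ n ^+ 3 * step_a1 n f = (1 - step_den n f) / 2 by rewrite dE; field.
    by field; rewrite gt_eqF.
  rewrite normrM normfV (gtr0_norm dp) ler_pdivrMr// normrM.
  rewrite normrN (ger0_norm (_ : 0 <= 9))//.
  have : 98 * sigma ^+ n ^+ 3 <= 100 * sigma ^+ n ^+ 3 * step_den n f by nra.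
  lra.
rewrite normrM normfV (gtr0_norm dp) ler_pdivrMr// normrM.
rewrite (gtr0_norm (_ : 0 < 3 * sigma ^+ n ^+ 3)) ?mulr_gt0//.
have : 98 * sigma ^+ n ^+ 3 <= 100 * sigma ^+ n ^+ 3 * step_den n f by nra.
have : sigma ^+ n ^+ 3 * `|step_a2 n f| <= sigma ^+ n ^+ 3 * 10.
  by rewrite ler_wpM2l// ltW.
lra.
Qed.

Lemma step_past_limit n (f : frame) w : frame_ok f -> sigma ^+ n <= 1 / 10 ->
  `| `|past (step n f) w| - past_limit w| <= 200 * eps n * zeta_abs w.
Proof.
move=> fo sn; apply: le_trans (ler_dist_dist _ _) _.
have -> : past (step n f) w - (psi w - 4 * zeta_re w) =
   (fpast1 (step n f) + 4) * zeta_re w + fpast2 (step n f) * zeta_im w by rewrite /past;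
     ring.
have [h1 h2] := step_fpast_bounds fo sn.
apply: le_trans (ler_normD _ _) _; rewrite (normrM (_ + _)) (normrM (fpast2 _)).
have : `|fpast1 (step n f) + 4| * `|zeta_re w| <= 100 * eps n * zeta_abs w.
  by rewrite ler_pM// hypot_ge_re.
have : `|fpast2 (step n f)| * `|zeta_im w| <= 100 * eps n * zeta_abs w.
  by rewrite ler_pM// hypot_ge_im.
lra.
Qed.

Lemma step_fscale_sqr n f : 0 < step_den n f ->
  fscale (step n f) ^+ 2 = fscale f ^+ 2 * (sigma ^+ n) ^- 2 * (step_den n f / 3).
Proof. by move=> d0; rewrite /= !exprMn exprVn step_scale_sqr. Qed.

(** The constant 5 only has to make the series of the displacements of the base
    point converge geometrically. *)
Lemma step_fscale n f : frame_ok f -> sigma ^+ n <= 1 / 10 ->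
  5 * fscale f <= fscale (step n f).
Proof.
move=> fo sn; have [/andP[d1 d2] _ _] := step_den_bounds fo sn.
have [y0 _ _] := fo; have s0 := sigman_gt0 n.
have dp : 0 < step_den n f by lra.
rewrite -(ler_pXn2r (n:=2)) ?nnegrE//; last 2 first.
- by rewrite mulr_ge0// ltW.
- by rewrite /= mulr_ge0 ?divr_ge0 ?sqrtr_ge0 ?ltW.
rewrite step_fscale_sqr// exprMn [leRHS]mulrAC -mulrA mulrC ler_wpM2l ?sqr_ge0//.
have : 100 <= sigma ^+ n ^- 2.
  rewrite -[leRHS]div1r ler_pdivlMr ?exprn_gt0 ?sigma_gt0//.
  rewrite -subr_ge0.
  have -> : 1 - 100 * sigma ^+ n ^+ 2 = 100 * ((1 / 10 - sigma ^+ n) * (1 / 10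
    + sigma ^+ n)).
    by field.
  by rewrite mulr_ge0// mulr_ge0; lra.
move: (sigma ^+ n ^- 2) (step_den n f) d1 => u D d1 u100.
have : 0 <= (D - 98 / 100) * (u - 100) by rewrite mulr_ge0// subr_ge0.
by rewrite expr2; lra.
Qed.

Lemma step_ok n f : frame_ok f -> sigma ^+ n <= 1 / 10 -> frame_ok (step n f).
Proof.
move=> fo sn; have [y0 _ _] := fo.
have [h1 h2] := step_fpast_bounds fo sn; have s0 := sigman_gt0 n.
have t0 : 0 < sigma ^+ n ^+ 3 by rewrite exprn_gt0.
have t1 : sigma ^+ n ^+ 3 <= 1 / 1000.
  have -> : 1 / 1000 = (1 / 10) ^+ 3 :> R by field.
  by rewrite lerXn2r ?nnegrE ?(ltW s0).
split; first by apply: lt_le_trans (step_fscale fo sn); rewrite mulr_gt0.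
  by move: h1; rewrite !ler_norml => /andP[h3 h4]; apply/andP; split; lra.
by lra.
Qed.

Lemma step_fpoint n f : frame_ok f -> sigma ^+ n <= 1 / 10 ->
  N (fpoint (step n f) - fpoint f) <= 3 * basis_size (fbasis f) * sigma ^+ n ^+ 3 /
    fscale f ^+ 3.
Proof.
move=> fo sn; have [/andP[d1 d2] _ _] := step_den_bounds fo sn.
have [y0 _ _] := fo; have s0 := sigman_gt0 n.
have dp : 0 < step_den n f by lra.
have -> : fpoint (step n f) - fpoint f =
  - ((2 / step_den n f * (sigma ^+ n ^+ 3 / fscale f ^+ 3)) *: (rotate (rotn n) (fbasis
    f)).1).
  rewrite [fpoint (step n f)]/= addrAC subrr add0r; congr (- (_ *: _)).
  have -> : fscale f / sigma ^+ n * step_scale n f = fscale (step n f) by [].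
  by rewrite step_fscale_sqr//; field; rewrite !gt_eqF.
rewrite N_opp N_scale -[leRHS]mulrA; set E := _ / fscale f ^+ 3.
have E0 : 0 <= E by rewrite divr_ge0 ?exprn_ge0 ?ltW ?sigma_gt0.
rewrite normrM (ger0_norm E0) ger0_norm ?divr_ge0 ?(ltW dp)//.
have nr := N_rot1 (fbasis f) (rotn_unit R n).
have D3 : 2 / step_den n f <= 3 by rewrite ler_pdivrMr//; lra.
rewrite -(mulrA _ E) -(mulrA 3) (mulrC (basis_size _)); apply: ler_pM => //.
- by rewrite divr_ge0 ?(ltW dp).
- by rewrite mulr_ge0 ?N_ge0.
- by rewrite ler_wpM2l.
Qed.

Lemma step_fbasis n f : frame_ok f -> sigma ^+ n <= 1 / 10 ->
  basis_dist (fbasis (step n f)) (limit_step (rotn n) (fbasis f)) <=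
    300 * sigma ^+ n ^+ 3 * basis_size (fbasis f).
Proof.
move=> fo sn; have [/andP[d1 d2] e1 d3] := step_den_bounds fo sn.
have [h1 h2] := step_fpast_bounds fo sn; have s0 := sigman_gt0 n.
have t0 : 0 < sigma ^+ n ^+ 3 by rewrite exprn_gt0.
have dp : 0 < step_den n f by lra.
have [s31 s32] := sqrt3_bounds; have s33 := sqrt3_sqr R.
have sc2 := step_scale_sqr dp.
have sc0 : 0 <= step_scale n f by exact: sqrtr_ge0.
have sc1 : step_scale n f <= 6 / 10.
  by rewrite -(ler_pXn2r (n:=2)) ?nnegrE// sc2; lra.
have n1 := N_rot1 (fbasis f) (rotn_unit R n); have n2 := N_rot2 (fbasis f) (rotn_unit R n).
have i3 : sqrt3^-1 = sqrt3 / 3.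
  have s30 : sqrt3 != 0 by rewrite gt_eqF// sqrt3_gt0.
  by apply: (mulfI s30); rewrite mulfV// mulrA -expr2 s33 divff.
set eps := sigma ^+ n ^+ 3 in t0 h1 h2 e1 d3 *.
have dsc : `|step_scale n f - sqrt3^-1| <= 12 * eps.
  have : (step_scale n f - sqrt3^-1) * (step_scale n f + sqrt3^-1) = (step_den n f - 1) / 3.
    by rewrite -subr_sqr sc2 i3 expr_div_n s33; field.
  move=> /(congr1 Num.norm); rewrite normrM [X in _ * X = _]ger0_norm; last first.
    by rewrite addr_ge0// invr_ge0 ltW// sqrt3_gt0.
  rewrite normrM normfV (ger0_norm (_ : 0 <= 3))// => eq1.
  have a0 := normr_ge0 (step_scale n f - sqrt3^-1).
  have : `|step_scale n f - sqrt3^-1| * (5666 / 10000) <= 20 * eps / 3.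
    apply: le_trans (_ : `|step_scale n f - sqrt3^-1| * (step_scale n f + sqrt3^-1) <= _).
      by apply: ler_wpM2l => //; rewrite i3; lra.
    by rewrite eq1 ler_pM2r.
  lra.
have k1 : `|step_scale n f * (2 * fpast1 (step n f) - 1) / 3 + sqrt3| <= 80 * eps.
  have -> : step_scale n f * (2 * fpast1 (step n f) - 1) / 3 + sqrt3 =
     - 3 * (step_scale n f - sqrt3^-1) + 2 / 3 * step_scale n f * (fpast1 (step n f) + 4).
    by rewrite i3; field.
  apply: le_trans (ler_normD _ _) _; rewrite !normrM normfV normrN.
  rewrite (ger0_norm (_ : 0 <= 3))// (ger0_norm (_ : 0 <= 2))// (ger0_norm sc0).
  have : step_scale n f * `|fpast1 (step n f) + 4| <= 6 / 10 * (100 * eps)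
    by rewrite ler_pM.
  lra.
have k3 : `|step_scale n f * (2 / 3 * fpast2 (step n f))| <= 40 * eps.
  rewrite normrM (ger0_norm sc0) normrM (ger0_norm (_ : 0 <= 2 / 3)) ?divr_ge0//.
  have : step_scale n f * `|fpast2 (step n f)| <= 6 / 10 * (100 * eps) by rewrite ler_pM.
  lra.
rewrite /basis_dist.
have -> : (fbasis (step n f)).1 - (limit_step (rotn n) (fbasis f)).1 =
  (step_scale n f * (2 * fpast1 (step n f) - 1) / 3
    + sqrt3) *: (rotate (rotn n) (fbasis f)).1.
  by rewrite /limit_step [fbasis _]/= [(_, _).1]/= [(_, _).1]/= scaleNr opprK -scalerDl.
have -> : (fbasis (step n f)).2 - (limit_step (rotn n) (fbasis f)).2 =
  (step_scale n f - sqrt3^-1) *: (rotate (rotn n) (fbasis f)).2 +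
  (step_scale n f * (2 / 3 * fpast2 (step n f))) *: (rotate (rotn n) (fbasis f)).1.
  rewrite /limit_step [fbasis _]/= [(_, _).2]/= [(_, _).2]/= scalerDr scalerBl scalerA.
  by rewrite addrAC.
have := N_triangle ((step_scale n f - sqrt3^-1) *: (rotate (rotn n) (fbasis f)).2)
  ((step_scale n f * (2 / 3 * fpast2 (step n f))) *: (rotate (rotn n) (fbasis f)).1).
rewrite !N_scale.
have : `|step_scale n f * (2 * fpast1 (step n f) - 1) / 3
  + sqrt3| * N (rotate (rotn n) (fbasis f)).1 <= 80 * eps * basis_size (fbasis f).
  by rewrite ler_pM ?N_ge0.
have : `|step_scale n f - sqrt3^-1| * N (rotate (rotn n) (fbasis f)).2 <=
  12 * eps * basis_size (fbasis f).
  by rewrite ler_pM ?N_ge0.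
have : `|step_scale n f * (2 / 3 * fpast2 (step n f))| * N (rotate (rotn n) (fbasis f)).1
  <= 40 * eps * basis_size (fbasis f).
  by rewrite ler_pM ?N_ge0.
have : 0 <= eps * basis_size (fbasis f) by rewrite mulr_ge0 ?basis_size_ge0 ?ltW.
lra.
Qed.

(** Limit steps are uniformly Lipschitz in the basis and in the rotation; h has
    norm sqrt 3 < 2. *)
Lemma limit_step_dist q q' v v' d : q.1 ^+ 2 + q.2 ^+ 2 = 1 ->
  `|q.1 - q'.1| <= d -> `|q.2 - q'.2| <= d ->
  basis_dist (limit_step q v) (limit_step q' v') <= 3 * basis_dist v v'
    + 3 * d * basis_size v'.
Proof.
move=> /unit_le1[q1 q2] d1 d2; have [s31 s32] := sqrt3_bounds.
have r1 : N ((rotate q v).1 - (rotate q' v').1) <= basis_dist v v' + d * basis_size v'.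
  have -> : (rotate q v).1 - (rotate q' v').1 = (q.1 *: (v.1 - v'.1) + q.2 *: (v.2 - v'.2))
     + ((q.1 - q'.1) *: v'.1 + (q.2 - q'.2) *: v'.2).
    by apply/rowP => j; rewrite !mxE; ring.
  apply: le_trans (N_triangle _ _) _; rewrite /basis_dist /basis_size mulrDr.
  apply: lerD; apply: le_trans (N_triangle _ _) _;
    rewrite !N_scale lerD// ?ler_wpM2r ?N_ge0//.
    by rewrite -[leRHS]mul1r ler_wpM2r ?N_ge0.
  by rewrite -[leRHS]mul1r ler_wpM2r ?N_ge0.
have r2 : N ((rotate q v).2 - (rotate q' v').2) <= basis_dist v v' + d * basis_size v'.
  have -> : (rotate q v).2 - (rotate q' v').2 = (- q.2 *: (v.1 - v'.1) + q.1 *: (v.2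
    - v'.2))
     + (- (q.2 - q'.2) *: v'.1 + (q.1 - q'.1) *: v'.2).
    by apply/rowP => j; rewrite !mxE; ring.
  apply: le_trans (N_triangle _ _) _; rewrite /basis_dist /basis_size mulrDr.
  apply: lerD; apply: le_trans (N_triangle _ _) _;
    rewrite !N_scale normrN lerD// ?ler_wpM2r ?N_ge0//.
    by rewrite -[leRHS]mul1r ler_wpM2r ?N_ge0.
  by rewrite -[leRHS]mul1r ler_wpM2r ?N_ge0.
rewrite {1}/basis_dist /= -!scalerBr !N_scale normrN normfV (ger0_norm (sqrtr_ge0 3)).
have : sqrt3 * N ((rotate q v).1 - (rotate q' v').1) <= 18 / 10 * (basis_dist v v'
  + d * basis_size v').
  by rewrite ler_pM ?N_ge0 ?sqrtr_ge0// ltW.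
have : sqrt3^-1 * N ((rotate q v).2 - (rotate q' v').2) <= 1 * (basis_dist v v'
  + d * basis_size v').
  rewrite ler_pM ?N_ge0 ?invr_ge0 ?sqrtr_ge0// invf_le1 ?sqrt3_gt0//; lra.
have : 0 <= basis_dist v v' by exact: basis_dist_ge0.
have : 0 <= d * basis_size v' by rewrite mulr_ge0 ?basis_size_ge0//; apply: le_trans d1.
lra.
Qed.

End Frames.

(** * The limit point and the quality of its approximations *)

Lemma norm_cauchy_limit (R : realType) (N : 'rV[R]_2 -> R) (normN : is_norm N)
    (u : nat -> 'rV[R]_2) (b : nat -> R) :
  (forall e, 0 < e -> exists k, b k <= e) ->
  (forall k m, (k <= m)%N -> N (u m - u k) <= b k) ->
  exists x, forall k, N (x - u k) <= b k.
Proof.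
move=> b0 ub; have [c c0 cN] := is_norm_coercive normN.
have cu : cvg (u @ \oo).
  apply/cauchy_cvgP/cauchy_exP => e e0.
  have [k bk] := b0 (c * e / 2) (divr_gt0 (mulr_gt0 c0 e0) (ltr0n _ 2)).
  exists (u k); suff : \forall m \near \oo, ball (u k) e (u m) by [].
  near=> m; rewrite -ball_normE /= distrC.
  have : c * `|u m - u k| <= c * e / 2.
    apply: le_trans (cN _) _; apply: le_trans bk.
    by apply: ub; near: m; exact: nbhs_infty_ge.
  rewrite -mulrA ler_pM2l//; lra.
exists (lim (u @ \oo)) => k.
have cN' : (fun m => N (u m - u k)) @ \oo --> N (lim (u @ \oo) - u k).
  apply: (@cvg_comp _ _ _ (fun m => u m - u k) N _ (nbhs (lim (u @ \oo) - u k))).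
    by apply: cvgB => //; exact: cvg_cst.
  exact: is_norm_continuous.
rewrite -(cvg_lim _ cN')//; apply: limr_le; first by apply/cvg_ex; eexists; exact: cN'.
near=> m; apply: ub; near: m; exact: nbhs_infty_ge.
Unshelve. all: by end_near.
Qed.

Section Limit.
Variable R : realType.
Local Notation V := 'rV[R]_2.
Variable N : V -> R.
Hypothesis normN : is_norm N.
Local Notation psi := (@psi R).
Local Notation zeta_re := (@zeta_re R).
Local Notation zeta_im := (@zeta_im R).
Local Notation zeta_abs := (@zeta_abs R).
Local Notation past_limit := (@past_limit R).
Local Notation sigma := (sigma R).
Local Notation eps n := (sigma ^+ n ^+ 3).
Local Notation frame := (frame R).

(** The quantity whose liminf is wanted, for one integer vector (p, q). *)
Definition quality (x : V) (w : Z3) : R :=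
  Num.sqrt `|zden R w| * N (znum R w - zden R w *: x).

Variables (n : nat -> nat) (fr : nat -> frame) (M : nat -> Z3 -> Z3).
Hypothesis frS : forall k, fr k.+1 = step (n k) (fr k).
Hypothesis MS : forall k, M k.+1 = step_map (n k) (M k).
Hypothesis fr0 : frame_ok (fr 0).
Hypothesis M0 : frame_of (M 0) (fr 0).
Hypothesis M0_surj : forall w, exists w', M 0 w' = w.
Hypothesis n_small : forall k, sigma ^+ (n k) <= 1 / 10.
Variables c C : R.
Hypothesis c0 : 0 < c.
Hypothesis hC : forall k, basis_size N (fbasis (fr k)) <= C.
Hypothesis hc : forall k x y, c * hypot x y <= frame_norm N (fbasis (fr k)) x y.

Lemma eps_ge0 m : 0 < eps m.
Proof. by rewrite !exprn_gt0// sigma_gt0. Qed.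

Lemma fr_ok k : frame_ok (fr k).
Proof. by elim: k => // k IHk; rewrite frS; apply: step_ok. Qed.

Lemma fr_of k : frame_of (M k) (fr k).
Proof.
elim: k => // k IHk; rewrite frS MS; apply: step_frame_of => //.
  by case: (fr_ok k).
have [/andP[d1 _] _ _] := step_den_bounds (fr_ok k) (n_small k).
by apply: lt_le_trans d1; rewrite divr_gt0.
Qed.

Lemma M_surj k w : exists w', M k w' = w.
Proof. by elim: k w => // k IHk w; rewrite MS; apply: step_map_surj. Qed.

Lemma C_ge0 : 0 <= C.
Proof. by apply: le_trans (hC 0); apply: basis_size_ge0. Qed.

Lemma fscale_gt0 k : 0 < fscale (fr k). Proof. by case: (fr_ok k). Qed.

(** The displacements are at most 3 C eps / fscale^3 and fscale grows by a factor
    5; comparing with a telescoping sum keeps track of the constant. *)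
Lemma fpoint_dist k eta m : (forall l, (k <= l)%N -> eps (n l) <= eta) ->
  (k <= m)%N -> N (fpoint (fr m) - fpoint (fr k)) <= 6 * C * eta / fscale (fr k) ^+ 3.
Proof.
move=> h km; have y0 := fscale_gt0; have C0 := C_ge0.
have eta0 : 0 <= eta by apply: le_trans (h k (leqnn k)); rewrite ltW// eps_ge0.
suff : N (fpoint (fr m) - fpoint (fr k)) <=
    6 * C * eta * ((fscale (fr k))^-1 ^+ 3 - (fscale (fr m))^-1 ^+ 3).
  move=> /le_trans; apply; rewrite -exprVn ler_wpM2l ?mulr_ge0//.
  by rewrite lerBlDr lerDl exprn_ge0// invr_ge0 ltW.
elim: m km => [|m IHm].
  by rewrite leqn0 => /eqP ->; rewrite !subrr mulr0 is_norm0.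
rewrite leq_eqVlt => /orP[/eqP <-|]; first by rewrite !subrr mulr0 is_norm0.
rewrite ltnS => km; have {}IHm := IHm km.
rewrite -(subrK (fpoint (fr m)) (fpoint (fr m.+1))) -addrA.
apply: le_trans (is_norm_triangle normN _ _) _.
have := step_fpoint normN (fr_ok m) (n_small m); rewrite -frS => s1.
have s2 : 3 * basis_size N (fbasis (fr m)) * eps (n m) / fscale (fr m) ^+ 3 <=
    3 * C * eta * (fscale (fr m))^-1 ^+ 3.
  rewrite exprVn; apply: ler_wpM2r; first by rewrite invr_ge0 exprn_ge0// ltW.
  have h1 : 0 <= 3 * basis_size N (fbasis (fr m)) by rewrite mulr_ge0 ?basis_size_ge0.
  have h2 : 3 * basis_size N (fbasis (fr m)) <= 3 * C by rewrite ler_wpM2l.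
  exact: ler_pM h1 (ltW (eps_ge0 _)) h2 (h _ km).
have s3 : (fscale (fr m.+1))^-1 ^+ 3 <= 1 / 2 * (fscale (fr m))^-1 ^+ 3.
  have s4 : (fscale (fr m.+1))^-1 <= (fscale (fr m))^-1 / 2.
    rewrite -invfM lef_pV2 ?posrE ?mulr_gt0//.
    have := step_fscale (fr_ok m) (n_small m); rewrite -frS.
    have := y0 m; lra.
  have y'0 : 0 < (fscale (fr m.+1))^-1 by rewrite invr_gt0.
  have yi0 : 0 < (fscale (fr m))^-1 by rewrite invr_gt0.
  apply: le_trans (_ : ((fscale (fr m))^-1 / 2) ^+ 3 <= _).
    by rewrite lerXn2r ?nnegrE// ?divr_ge0// ltW.
  rewrite expr_div_n mulrC; apply: ler_wpM2r; first by rewrite exprn_ge0// ltW.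
  by rewrite div1r lef_pV2 ?posrE ?exprn_gt0// -[leLHS]expr1 ler_weXn2l// ler1n.
have := le_trans s1 s2.
have : 0 <= 6 * C * eta * (1 / 2 * (fscale (fr m))^-1 ^+ 3 - (fscale (fr m.+1))^-1 ^+ 3).
  by rewrite mulr_ge0 ?mulr_ge0// subr_ge0.
move: IHm; move: (N _) (N _) => N1 N2; move: (_ ^+ 3) (_ ^+ 3) (_ ^+ 3) => X1 X2 X3.
move: (C * eta) => Ce; lra.
Qed.

Lemma eps_small k : eps (n k) <= 1.
Proof.
have := n_small k; have := sigman_gt0 R (n k) => s0 s1.
by rewrite exprn_ile1// ?ltW//; lra.
Qed.

Lemma limit_point_exists : exists x, forall k eta,
  (forall l, (k <= l)%N -> eps (n l) <= eta) ->
  N (x - fpoint (fr k)) <= 6 * C * eta / fscale (fr k) ^+ 3.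
Proof.
have C0 := C_ge0; have y0 := fscale_gt0.
have ygrow k : fscale (fr 0) * k%:R <= fscale (fr k).
  elim: k => [|k IHk]; first by rewrite mulr0 ltW.
  have := step_fscale (fr_ok k) (n_small k); rewrite -frS.
  have -> : k.+1%:R = k%:R + 1 :> R by rewrite natr1.
  rewrite mulrDr mulr1; case: k IHk => [|k] IHk; first by rewrite mulr0; have := y0 0; lra.
  have : fscale (fr 0) * 1 <= fscale (fr 0) * k.+1%:R by rewrite ler_pM2l// ler1n.
  have := y0 k.+1; lra.
have bnd e : 0 < e -> exists k, 6 * C * 1 / fscale (fr k) ^+ 3 <= e.
  move=> e0; pose K := (Num.truncn (Num.max 1 (6 * C / e) / fscale (fr 0))).+1.
  exists K.
  have yK : Num.max 1 (6 * C / e) <= fscale (fr K).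
    apply: le_trans (ygrow K); rewrite -ler_pdivrMl// mulrC.
    exact: ltW (truncnS_gt _).
  have [y1 y2] : 1 <= fscale (fr K) /\ 6 * C / e <= fscale (fr K).
    by move: yK; rewrite ge_max => /andP.
  rewrite mulr1 ler_pdivrMr ?exprn_gt0// -ler_pdivrMl// [e^-1 * _]mulrC.
  apply: le_trans y2 _; rewrite -[leLHS]expr1; exact: ler_weXn2l.
have [x xP] := norm_cauchy_limit normN bnd
  (fun k m km => fpoint_dist (fun l _ => eps_small l) km).
exists x => k eta h.
apply/ler_addgt0Pr => e e0; have [m xm] := bnd e e0.
have [km|mk] := leqP k m.
  rewrite -(subrK (fpoint (fr m)) x) -addrA; apply: le_trans (is_norm_triangle normN _ _) _.
  by rewrite [leRHS]addrC; apply: lerD; [exact: le_trans (xP m) xm|exact: fpoint_dist].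
have xk : N (x - fpoint (fr k)) <= e.
  apply: le_trans (xP k) _; apply: le_trans xm.
  rewrite ler_wpM2l ?mulr_ge0// lef_pV2 ?posrE ?exprn_gt0//.
  rewrite lerXn2r ?nnegrE ?ltW//.
  elim: k mk {h} => // k IHk; rewrite ltnS leq_eqVlt => /orP[/eqP ->|/IHk le1].
    have := step_fscale (fr_ok k) (n_small k); rewrite -frS; have := y0 k; lra.
  have := step_fscale (fr_ok k) (n_small k); rewrite -frS; have := y0 k; lra.
apply: le_trans xk _; rewrite lerDr.
have eta0 : 0 <= eta by apply: le_trans (h k (leqnn k)); rewrite ltW// eps_ge0.
by apply: divr_ge0; [rewrite !mulr_ge0|rewrite exprn_ge0// ltW].
Qed.

Variable x : V.
Hypothesis hx : forall k eta,
  (forall l, (k <= l)%N -> eps (n l) <= eta) ->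
  N (x - fpoint (fr k)) <= 6 * C * eta / fscale (fr k) ^+ 3.

(** In the frame of stage k the quality is an explicit expression in psi and zeta,
    up to the displacement x - fpoint multiplied by fscale^3, which is at most
    6 C eta in norm. *)
Lemma quality_frame k w eta : (forall l, (k <= l)%N -> eps (n l) <= eta) ->
  Num.sqrt `|past (fr k) w| * (frame_norm N (fbasis (fr k)) (zeta_re w) (zeta_im w)
    - `|past (fr k) w| * (6 * C * eta)) <= quality x (M k w) <=
  Num.sqrt `|past (fr k) w| * (frame_norm N (fbasis (fr k)) (zeta_re w) (zeta_im w)
    + `|past (fr k) w| * (6 * C * eta)).
Proof.
move=> h; set p := `|past (fr k) w|; set v := frame_norm _ _ _ _.
have y0 := fscale_gt0 k.
have [Hq Hp] := fr_of k w.
pose E := fscale (fr k) ^+ 3 *: (x - fpoint (fr k)).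
have NE : N E <= 6 * C * eta.
  rewrite /E is_norm_scale// ger0_norm ?exprn_ge0 ?(ltW y0)//.
  by rewrite -ler_pdivlMl ?exprn_gt0// [leRHS]mulrC hx.
have -> : quality x (M k w) = Num.sqrt p * N (comb (fbasis (fr k)) (zeta_re w) (zeta_im
  w) - past (fr k) w *: E).
  rewrite /quality Hp Hq normrM ger0_norm ?exprn_ge0 ?(ltW y0)//.
  rewrite sqrtrM ?exprn_ge0 ?(ltW y0)// sqrtr_sqr (gtr0_norm y0).
  rewrite -mulrA mulrCA; congr (_ * _).
  rewrite -{1}(gtr0_norm y0) -is_norm_scale//; congr N.
  by rewrite /E; apply/rowP => j; rewrite !mxE; field; rewrite gt_eqF.
have := is_norm_dist (comb (fbasis (fr k)) (zeta_re w) (zeta_im w)) (comb (fbasis (fr k))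
  (zeta_re w) (zeta_im w) - past (fr k) w *: E) normN.
rewrite subKr is_norm_scale// -/p.
have pE : p * N E <= p * (6 * C * eta) by rewrite ler_wpM2l// normr_ge0.
rewrite -/v.
have -> : N (comb (fbasis (fr k)) (zeta_re w) (zeta_im w)) = v by [].
rewrite ler_norml => /andP[b1 b2].
by apply/andP; split; apply: ler_wpM2l; rewrite ?sqrtr_ge0//; lra.
Qed.

Lemma past_near_limit k w :
  `| `|past (fr k.+1) w| - past_limit w| <= 200 * eps (n k) * zeta_abs w.
Proof. by rewrite frS; apply: step_past_limit (n_small k); exact: fr_ok. Qed.

Lemma past_le k w : `|past (fr k) w| <= `|psi w| + 10 * zeta_abs w.
Proof.
have [_ h1 h2] := fr_ok k.
rewrite /past -addrA; apply: le_trans (ler_normD _ _) _; rewrite lerD2l.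
apply: le_trans (ler_normD _ _) _; rewrite !normrM.
have : `|fpast1 (fr k)| * `|zeta_re w| <= 5 * zeta_abs w by rewrite ler_pM// hypot_ge_re.
have : `|fpast2 (fr k)| * `|zeta_im w| <= 5 * zeta_abs w by rewrite ler_pM// hypot_ge_im.
lra.
Qed.

(** Far from the kernel of the denominator form (at threshold K eps) and far from
    the axis zeta = 0 (at threshold K^-2), the error in the form and the error
    from the displacement are both O(1/K) relative to the main terms. *)
Lemma quality_ge k w K rho d : 0 < d -> d <= rho -> 1 <= K ->
  (forall l, (k <= l)%N -> eps (n l) <= K ^- 3) ->
  (200 + 66 * C / c) / K <= d / (2 * rho) ->
  rho - d / 2 <= Num.sqrt (past_limit w) * frame_norm N (fbasis (fr k.+1)) (zeta_re w)
    (zeta_im w) ->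
  K * eps (n k) * zeta_abs w <= past_limit w ->
  K ^- 2 * `|psi w| <= zeta_abs w ->
  rho - d <= quality x (M k.+1 w).
Proof.
move=> d0 drho K1 h hK cost hp hf.
have K0 : 0 < K by lra.
have C0 := C_ge0; have z0 := zeta_abs_ge0 R w.
have rho0 : 0 < rho by lra.
have h' l : (k.+1 <= l)%N -> eps (n l) <= K ^- 3 by move=> kl; apply: h; exact: ltnW.
have /andP[+ _] := quality_frame w h'.
set p := `|_|; set v := frame_norm _ _ _ _; set g := past_limit w in hp cost *.
move=> F1; apply: le_trans F1.
have g0 : 0 <= g by exact: normr_ge0.
have v0 : 0 <= v by exact: frame_norm_ge0.
pose a := 200 / K; pose b := 66 * C / c / K.
have ab : a + b <= d / (2 * rho) by move: hK; rewrite mulrDl.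
have a0 : 0 <= a by rewrite divr_ge0 ?ler0n ?(ltW K0).
have b0 : 0 <= b by rewrite divr_ge0 ?divr_ge0 ?mulr_ge0// ltW.
have d2 : d / (2 * rho) <= 1 / 2.
  by rewrite ler_pdivrMr ?mulr_gt0//; lra.
have p1 : (1 - a) * g <= p.
  have := past_near_limit k w; rewrite -/p -/g => /ler_normlP[+ _].
  have : 200 * eps (n k) * zeta_abs w <= a * g.
    have -> : 200 * eps (n k) * zeta_abs w = a * (K * eps (n k) * zeta_abs w).
      by rewrite /a; field; rewrite gt_eqF.
    by apply: ler_wpM2l.
  lra.
have p2 : p * (6 * C * K ^- 3) <= b * v.
  have p3 : p <= (K ^+ 2 + 10) * zeta_abs w.
    apply: le_trans (past_le _ _) _; rewrite [leRHS]mulrDl lerD2r.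
    by rewrite -ler_pdivrMl ?exprn_gt0//.
  have cv : c * zeta_abs w <= v by exact: hc.
  have Ki : 0 <= K ^- 3 by rewrite invr_ge0 exprn_ge0// ltW.
  apply: le_trans (_ : b * (c * zeta_abs w) <= _); last by rewrite ler_wpM2l.
  apply: le_trans (_ : (K ^+ 2 + 10) * zeta_abs w * (6 * C * K ^- 3) <= _).
    by rewrite ler_wpM2r// mulr_ge0 ?mulr_ge0.
  have K2 : K ^+ 2 + 10 <= 11 * K ^+ 2.
    have : 1 <= K ^+ 2 by rewrite exprn_ege1.
    lra.
  apply: le_trans (_ : 11 * K ^+ 2 * zeta_abs w * (6 * C * K ^- 3) <= _).
    by rewrite ler_wpM2r ?ler_wpM2r// mulr_ge0 ?mulr_ge0.
  by rewrite /b le_eqVlt; apply/orP; left; apply/eqP; field; rewrite !gt_eqF.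
have p0 : 0 <= p by exact: normr_ge0.
have sp : (1 - a) * Num.sqrt g <= Num.sqrt p.
  apply: le_trans (ler_wsqrtr p1).
  rewrite sqrtrM; last by lra.
  rewrite ler_wpM2r ?sqrtr_ge0// -[leLHS]ger0_norm; last by lra.
  rewrite -sqrtr_sqr ler_wsqrtr//; nra.
have a1 : 0 <= 1 - a by lra.
have b1 : 0 <= 1 - b by lra.
have sg0 : 0 <= Num.sqrt g by exact: sqrtr_ge0.
have pv : (1 - b) * v <= v - p * (6 * C * K ^- 3).
  by rewrite mulrBl mul1r lerD2l lerN2.
apply: le_trans (ler_pM (mulr_ge0 a1 sg0) (mulr_ge0 b1 v0) sp pv).
rewrite mulrACA.
have ab0 : 0 <= a * b by rewrite mulr_ge0.
have ab1 : 1 - (a + b) <= (1 - a) * (1 - b) by rewrite mulrBl mul1r mulrBr mulr1; lra.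
have r0 : 0 <= rho - d / 2 by lra.
have ab2 : 0 <= 1 - (a + b) by lra.
apply: le_trans (ler_pM ab2 r0 ab1 cost).
have ab3 : (a + b) * (rho - d / 2) <= d / (2 * rho) * rho.
  by apply: ler_pM => //; [rewrite addr_ge0|lra].
have e1 : d / (2 * rho) * rho = d / 2 by field; rewrite gt_eqF.
rewrite e1 in ab3; rewrite mulrBl mul1r; lra.
Qed.

(** A vector very close to the axis at one stage is, at the next one, far from
    the kernel of the new denominator form: u^-n multiplies zeta / psi by
    1 / eps n, so psi is not too small against zeta just before the flip. *)
Lemma chain_step k w K : 1 <= K -> eps (n k) <= K ^- 3 ->
  zeta_abs w < K ^- 2 * `|psi w| ->
  exists w', [/\ M k.+1 w' = M k w, K * eps (n k) * zeta_abs w' <= past_limit w' &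
                 `|psi (flip w')| <= `|psi w| / 100].
Proof.
move=> K1 hK zw; have [u uE] := iter_unit_surj (n k) w.
have K0 : 0 < K by apply: lt_le_trans K1.
exists (flip u); rewrite MS /step_map flipK uE; split=> //.
  rewrite past_limitE flipK.
  have zu : sigma ^+ (n k) ^+ 3 * zeta_abs u <= K ^- 2 * `|psi u|.
    move: zw; rewrite -uE zeta_abs_iter psi_iter normrM.
    move: (sigman_gt0 R (n k)); move: (sigma ^+ n k) => t t0.
    rewrite (ger0_norm (_ : 0 <= t^-1 ^+ 2)) ?sqr_ge0// => /ltW.
    rewrite -(ler_pM2l (exprn_gt0 2 t0)) => /le_trans h.
    rewrite exprSr -mulrA; apply: h.
    by rewrite le_eqVlt; apply/orP; left; apply/eqP; field; rewrite !gt_eqF.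
  have zf := zeta_abs_flip_le R u.
  have t0 := eps_ge0 (n k); move: (eps (n k)) t0 zu hK => e e0 zu hK.
  have Ki : K ^- 2 <= 1 by rewrite invf_le1 ?exprn_gt0// exprn_ege1.
  have K3 : K * e <= 1.
    apply: le_trans (_ : K * K ^- 3 <= _); first by rewrite ler_pM2l.
    have -> : K * K ^- 3 = K ^- 2 by field; rewrite gt_eqF.
    by [].
  have K4 : K * (e * zeta_abs u) <= `|psi u|.
    apply: le_trans (_ : K * (K ^- 2 * `|psi u|) <= _); first by rewrite ler_pM2l.
    have -> : K * (K ^- 2 * `|psi u|) = K^-1 * `|psi u| by field; rewrite gt_eqF.
    by rewrite -[leRHS]mul1r ler_wpM2r// invf_le1.
  apply: le_trans (_ : K * e * (zeta_abs u + `|psi u|) <= _).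
    by rewrite ler_wpM2l// mulr_ge0// ltW.
  rewrite mulrDr -[K * e * zeta_abs u]mulrA.
  have : K * e * `|psi u| <= 1 * `|psi u| by rewrite ler_wpM2r.
  have := normr_ge0 (psi u); lra.
rewrite -uE psi_iter normrM.
have := n_small k; move: (sigman_gt0 R (n k)); move: (sigma ^+ n k) => t t0 t1.
rewrite (ger0_norm (_ : 0 <= t^-1 ^+ 2)) ?sqr_ge0// mulrAC.
rewrite ler_peMl// ler_pdivlMr// mul1r exprVn -[leRHS]div1r.
rewrite ler_pdivlMr ?exprn_gt0//.
rewrite -subr_ge0.
have -> : 1 - 100 * t ^+ 2 = 100 * ((1 / 10 - t) * (1 / 10 + t)) by field.
by rewrite mulr_ge0// mulr_ge0; lra.
Qed.

Hypothesis n_lim : forall e, 0 < e -> exists k0, forall k, (k0 <= k)%N -> eps (n k) <= e.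
Variable rho : R.
Hypothesis rho0 : 0 < rho.
Hypothesis cost_ge : forall d, 0 < d -> exists k0, forall k w, (k0 <= k)%N ->
  w != (0, 0, 0) ->
  rho - d <= Num.sqrt (past_limit w) * frame_norm N (fbasis (fr k)) (zeta_re w) (zeta_im w).

Lemma quality_ge0 w : 0 <= quality x w.
Proof. by rewrite mulr_ge0 ?sqrtr_ge0 ?is_norm_ge0. Qed.

(** A good approximation with large denominator is close to x, so that in a fixed
    frame it lies near the axis, away from the kernel of the denominator form.
    This starts the chain of [chain_step]. *)
Lemma enter_chain k w K :
  1 <= K -> (6 * C + 1) / c <= K / 1000 ->
  (forall l, (k <= l)%N -> eps (n l) <= K ^- 3) ->
  1 <= `|past (fr k.+1) w| -> rho <= K ^- 3 * `|past (fr k.+1) w| ->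
  quality x (M k.+1 w) < rho ->
  K * eps (n k) * zeta_abs w <= past_limit w.
Proof.
move=> K1 hK h p1 rp F1.
have K0 : 0 < K by apply: lt_le_trans K1.
have C0 := C_ge0; have z0 := zeta_abs_ge0 R w.
have h' l : (k.+1 <= l)%N -> eps (n l) <= K ^- 3 by move=> kl; apply: h; exact: ltnW.
have /andP[+ _] := quality_frame w h'.
have pg := past_near_limit k w; have hk := h k (leqnn k); have e0 := eps_ge0 (n k).
have cz : c * zeta_abs w <= frame_norm N (fbasis (fr k.+1)) (zeta_re w) (zeta_im w)
  by exact: hc.
have Ki3 : 0 < K ^- 3 by rewrite invr_gt0 exprn_gt0.
have KK : K * K ^- 3 <= 1.
  have -> : K * K ^- 3 = K ^- 2 by field; rewrite gt_eqF.
  by rewrite invf_le1 ?exprn_gt0// exprn_ege1.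
have Ki1 : K ^- 3 <= 1 by rewrite invf_le1 ?exprn_gt0// exprn_ege1.
move: (frame_norm _ _ _ _) (`|past _ _|) (past_limit w) (eps (n k)) (K ^- 3) p1 rp pg hk
  cz Ki3 KK Ki1 e0.
move=> v p g e y p1 rp /ler_normlP[_ pg] hk cz y0 Ky y1 e0 F2.
have sp : 1 <= Num.sqrt p by rewrite -sqrtr1 ler_wsqrtr.
have v1 : v - p * (6 * C * y) <= rho.
  have [//|lt] := leP (v - p * (6 * C * y)) rho.
  have : v - p * (6 * C * y) <= Num.sqrt p * (v - p * (6 * C * y)).
    by apply: ler_peMl => //; exact: ltW (lt_trans rho0 lt).
  by move=> /le_trans/(_ F2) h1; have := le_lt_trans h1 F1; rewrite ltNge (ltW lt).
have cz1 : c * zeta_abs w <= (6 * C + 1) * (y * p).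
  have e1 : p * (6 * C * y) = 6 * C * (y * p) by ring.
  rewrite e1 in v1; rewrite mulrDl mul1r; lra.
have [q pq] : exists q, p = 1000 * q by exists (p / 1000); field.
have [L KL] : exists L, K = 1000 * L by exists (K / 1000); field.
have q0 : 0 <= q by lra.
have hL : (6 * C + 1) / c <= L by move: hK; rewrite KL; lra.
have z1 : zeta_abs w <= q.
  have -> : zeta_abs w = c^-1 * (c * zeta_abs w) by rewrite mulKf// gt_eqF.
  apply: le_trans (_ : c^-1 * ((6 * C + 1) * (y * p)) <= _).
    by rewrite ler_wpM2l// invr_ge0 ltW.
  rewrite mulrA [c^-1 * _]mulrC.
  have yp0 : 0 <= y * p by rewrite mulr_ge0 ?(ltW y0)//; lra.
  apply: le_trans (ler_wpM2r yp0 hL) _.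
  have -> : L * (y * p) = K * y * q by rewrite pq KL; ring.
  by rewrite -[leRHS]mul1r ler_wpM2r.
have ez : e * zeta_abs w <= q.
  by rewrite -[leRHS]mul1r; apply: ler_pM => //; [exact: ltW|exact: le_trans hk y1].
have Ke : K * e <= 1 by apply: le_trans Ky; rewrite ler_pM2l.
have Kez : K * e * zeta_abs w <= q.
  by rewrite -[leRHS]mul1r; apply: ler_pM => //; rewrite mulr_ge0// ltW.
move: pg; rewrite -mulrA; lra.
Qed.

Lemma expn2_unbounded (B : R) : exists i, B < 2 ^+ i.
Proof.
exists (Num.truncn B).+1; apply: lt_trans (truncnS_gt _) _.
by rewrite -natrX ltr_nat ltn_expl.
Qed.

(** Suppose that (p, q) with q large has quality below rho - d.  It enters the
    chain at a fixed stage; it can never satisfy both conditions of [quality_ge],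
    hence stays close to the axis at every later stage, while psi is divided by
    at least 2 each time.  Then the norm psi * |zeta|^2 would tend to 0. *)
Lemma quality_liminf_ge d : 0 < d ->
  exists Q, forall w, Q <= `|zden R w| -> rho - d <= quality x w.
Proof.
move=> d0; wlog drho : d d0 / d <= rho.
  move=> wl; have [le|lt] := leP d rho; first exact: wl.
  by exists 0 => w _; apply: le_trans (quality_ge0 w); rewrite subr_le0 ltW.
have C0 := C_ge0.
have [A AE] : exists A, A = (6 * C + 1) / c by exists ((6 * C + 1) / c).
have [B BE] : exists B, B = (200 + 66 * C / c) * (2 * rho / d) by eexists.
have A0 : 0 <= A by rewrite AE divr_ge0 ?(ltW c0)// addr_ge0 ?mulr_ge0.
have B0 : 0 <= B.
  by rewrite BE !mulr_ge0 ?addr_ge0 ?mulr_ge0 ?invr_ge0 ?(ltW c0) ?(ltW d0) ?(ltW rho0).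
(* A makes the entry into the chain possible, B makes the relative errors at
   most d / (2 rho), and 3 makes K^-2 <= 1/9 in the descent of psi. *)
have [K KE] : exists K, K = 1000 * A + B + 3 by eexists.
have K3 : 3 <= K by lra.
have K0 : 0 < K by apply: lt_le_trans K3.
have K1 : 1 <= K by lra.
have hA : A <= K / 1000 by lra.
have hB : (200 + 66 * C / c) / K <= d / (2 * rho).
  rewrite ler_pdivrMr//.
  have <- : d / (2 * rho) * B = 200 + 66 * C / c by rewrite BE; field; rewrite !gt_eqF.
  apply: ler_wpM2l; last by lra.
  by rewrite divr_ge0 ?mulr_ge0 ?(ltW d0) ?(ltW rho0).
have Ki3 : 0 < K ^- 3 by rewrite invr_gt0 exprn_gt0.
have [k1 hk1] := n_lim Ki3.
have d20 : 0 < d / 2 by rewrite divr_gt0.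
have [k2 hk2] := cost_ge d20.
pose k := maxn k1 k2.
have hk l : (k <= l)%N -> eps (n l) <= K ^- 3.
  by move=> kl; apply: hk1; apply: leq_trans kl; exact: leq_maxl.
have hcost l w : (k <= l)%N -> w != (0, 0, 0) ->
   rho - d / 2 <= Num.sqrt (past_limit w) * frame_norm N (fbasis (fr l)) (zeta_re w)
     (zeta_im w).
  by move=> kl; apply: hk2; apply: leq_trans kl; exact: leq_maxr.
pose y := fscale (fr k.+1); have y0 : 0 < y by exact: fscale_gt0.
exists (y ^+ 2 * (1 + rho * K ^+ 3)) => w0 w0Q; rewrite leNgt; apply/negP => Flt.
have P0 : 1 <= 1 + rho * K ^+ 3 by rewrite lerDl mulr_ge0 ?(ltW rho0)// exprn_ge0// ltW.
have neq0 l w : M l w = w0 -> w != (0, 0, 0).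
  move=> wE; apply/eqP => w_0; move: w0Q; have [+ _] := fr_of l w.
  have -> : past (fr l) w = 0 by rewrite w_0 /past /=; ring.
  rewrite wE mulr0 => ->; rewrite normr0.
  by rewrite leNgt mulr_gt0 ?exprn_gt0//; lra.
have [w1 w1E] := M_surj k.+1 w0.
have p_big : 1 + rho * K ^+ 3 <= `|past (fr k.+1) w1|.
  move: w0Q; rewrite -w1E; have [-> _] := fr_of k.+1 w1.
  by rewrite normrM (ger0_norm (sqr_ge0 _)) ler_pM2l// exprn_gt0.
have chain i : exists w, [/\ M (k + i).+1 w = w0,
    K * eps (n (k + i)) * zeta_abs w <= past_limit w & `|psi w| * 2 ^+ i <= `|psi w1|].
  elim: i => [|i [w [wE pw dw]]].
    exists w1; rewrite addn0 expr0 mulr1; split=> //.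
    rewrite AE in hA; apply: enter_chain => //; last by rewrite w1E; lra.
      by apply: le_trans p_big; lra.
    rewrite -ler_pdivrMl// invrK mulrC; apply: le_trans p_big; lra.
  have zw : zeta_abs w < K ^- 2 * `|psi w|.
    rewrite ltNge; apply/negP => fut; move: Flt; rewrite ltNge -wE => /negP; apply.
    apply: quality_ge (pw) fut => //.
      by move=> l kl; apply: hk; apply: leq_trans kl; exact: leq_addr.
    by apply: hcost (neq0 _ _ wE); rewrite ltnW// ltnS leq_addr.
  have kki : (k <= (k + i).+1)%N by rewrite ltnW// ltnS leq_addr.
  have [w' [w'E pw' dw']] := chain_step K1 (hk _ kki) zw.
  rewrite wE in w'E; rewrite addnS; exists w'; split=> //.
  have zw' : zeta_abs w' < K ^- 2 * `|psi w'|.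
    rewrite ltNge; apply/negP => fut; move: Flt; rewrite ltNge -w'E => /negP; apply.
    apply: quality_ge (pw') fut => //.
      by move=> l kl; apply: hk; apply: leq_trans kl; rewrite ltnW// ltnS leq_addr.
    by apply: hcost (neq0 _ _ w'E); rewrite ltnW// ltnS ltnW// ltnS leq_addr.
  have K2 : K ^- 2 * `|psi w'| <= `|psi w'| / 9.
    rewrite mulrC ler_wpM2l// lef_pV2 ?posrE ?exprn_gt0// expr2.
    have : 3 * 3 <= K * K by apply: ler_pM.
    lra.
  have : `|psi w'| / 6 <= `|psi (flip w')|.
    rewrite psi_flip normrM normfV (ger0_norm (_ : 0 <= 3))//.
    have := lerB_dist (psi w') (4 * zeta_re w'); rewrite normrM (ger0_norm (_ : 0 <= 4))//.
    have := hypot_ge_re (zeta_re w') (zeta_im w'); rewrite -/(zeta_abs w').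
    move: (le_trans (ltW zw') K2) (normr_ge0 (psi w')); lra.
  move=> hf; have pw2 : `|psi w'| * 2 <= `|psi w|.
    by move: hf dw' (normr_ge0 (psi w)); lra.
  rewrite exprS mulrA; apply: le_trans dw; rewrite ler_wpM2r// exprn_ge0//.
have [i Bi] := expn2_unbounded `|psi w1|.
have [w [wE pw dw]] := chain i.
have zw : zeta_abs w < K ^- 2 * `|psi w|.
  rewrite ltNge; apply/negP => fut; move: Flt; rewrite ltNge -wE => /negP; apply.
  apply: quality_ge (pw) fut => //.
    by move=> l kl; apply: hk; apply: leq_trans kl; exact: leq_addr.
  by apply: hcost (neq0 _ _ wE); rewrite ltnW// ltnS leq_addr.
have p1 : `|psi w| < 1.
  have i2 : 0 < 2 ^+ i :> R by rewrite exprn_gt0.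
  by rewrite -(ltr_pM2r i2) mul1r; apply: le_lt_trans Bi.
have := psi_zeta_ge1 R (neq0 _ _ wE); rewrite leNgt => /negP; apply.
have z0 := zeta_abs_ge0 R w.
have Ki2 : K ^- 2 <= 1 by rewrite invf_le1 ?exprn_gt0// exprn_ege1.
have z1 : zeta_abs w < 1.
  apply: lt_le_trans zw _; apply: le_trans (_ : 1 * 1 <= _); last by rewrite mulr1.
  by apply: ler_pM => //; rewrite ?invr_ge0 ?exprn_ge0 ?ltW.
have z2 : zeta_abs w ^+ 2 <= 1 by rewrite exprn_ile1// ltW.
by apply: le_lt_trans p1; rewrite ler_piMr.
Qed.

Lemma quality_le k w eta B : (forall l, (k <= l)%N -> eps (n l) <= eta) ->
  Num.sqrt `|past (fr k) w| * (frame_norm N (fbasis (fr k)) (zeta_re w) (zeta_im w)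
    + `|past (fr k) w| * (6 * C * eta)) <= B -> quality x (M k w) <= B.
Proof. by move=> /quality_frame h; apply: le_trans; have /andP[] := h w. Qed.

End Limit.

(** * From the quality function to the liminf on the torus *)

Section Liminf.
Variable R : realType.
Local Notation V := 'rV[R]_2.
Variable N : V -> R.
Hypothesis normN : is_norm N.

Lemma limn_einf_fin_eq (a : nat -> R) (rho : R) :
  (forall d, 0 < d -> exists Q : nat, forall q, (Q <= q)%N -> rho - d <= a q) ->
  (forall d Q, 0 < d -> exists q, (Q <= q)%N /\ a q <= rho + d) ->
  limn_einf (fun q => (a q)%:E) = rho%:E.
Proof.
move=> low up; rewrite limn_einf_lim; apply/eqP; rewrite eq_le; apply/andP; split.
  apply: lime_le; first exact: is_cvg_einfs.
  apply: nearW => Q; apply/lee_addgt0Pr => d d0.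
  have [q [Qq aq]] := up d Q d0.
  apply: le_trans (_ : (a q)%:E <= _)%E; last by rewrite -EFinD lee_fin.
  by apply: ereal_inf_lbound; exists q.
apply/lee_addgt0Pr => d d0; have [Q lowQ] := low d d0.
rewrite -leeBlDr// -EFinB; apply: lime_ge; first exact: is_cvg_einfs.
near=> n; apply: le_ereal_inf_tmp => _ [q /= nq <-]; rewrite lee_fin.
apply: lowQ; apply: leq_trans nq; near: n; exact: nbhs_infty_ge.
Unshelve. all: by end_near.
Qed.

Definition int_row (z : 'rV[int]_2) : V := map_mx (intr : int -> R) z.

Lemma znum_int_row (z : 'rV[int]_2) (c : int) :
  znum R (z ord0 0, z ord0 1, c) = int_row z.
Proof.
apply/rowP => j; rewrite /znum /int_row !mxE.
have [->|->] : j = 0 \/ j = 1.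
  by case: j => [[|[|//]] lt]; [left|right]; apply: val_inj.
- by rewrite eqxx /= mulr1 mulr0 addr0.
- by rewrite eqxx /= mulr0 mulr1 add0r.
Qed.

Lemma torus_quality (x : V) (q : nat) : exists w : Z3, zden R w = q%:R /\
  Num.sqrt q%:R * torus_norm N (q%:R *: x) = quality N x w.
Proof.
have [_ [z _ <-] [-> _]] := torus_norm_min (q%:R *: x) normN.
exists (z ord0 0, z ord0 1, q%:Z); split => //.
rewrite /quality znum_int_row /zden /= (ger0_norm (ler0n _ q)); congr (_ * _).
by rewrite -(is_normN (_ - _) normN) opprB.
Qed.

Lemma quality_torus (x : V) (w : Z3) : exists q : nat, q%:R = `|zden R w| /\
  Num.sqrt q%:R * torus_norm N (q%:R *: x) <= quality N x w.
Proof.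
case: w => [[a b] c].
have torus_le (q : nat) (p : 'rV[int]_2) : torus_norm N (q%:R *: x) <= N (q%:R *: x
  - int_row p).
  have [p1 _ [-> le_p]] := torus_norm_min (q%:R *: x) normN.
  by apply: le_p; exists p.
pose z := \row_(j < 2) (if j == 0 then a else b) : 'rV[int]_2.
have zE : (a, b, c) = (z ord0 0, z ord0 1, c) by rewrite !mxE.
exists `|c|%N; have cE : `|c|%:R = `|c%:~R| :> R by rewrite -intr_norm natr_absz.
split => //; rewrite /quality zE znum_int_row /zden -cE ler_wpM2l ?sqrtr_ge0//.
have [c0|c0] := leP 0 c.
  have -> : c%:~R = `|c|%:R :> R by rewrite cE ger0_norm// ler0z.
  by rewrite -(is_normN (_ - _) normN) opprB torus_le.
have -> : c%:~R = - `|c|%:R :> R by rewrite cE ltr0_norm ?opprK// ltrz0.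
apply: le_trans (torus_le _ (- z)) _; rewrite scaleNr opprK.
by rewrite /int_row map_mxN opprK addrC.
Qed.

Lemma liminf_torus_eq (x : V) (rho : R) :
  (forall d, 0 < d -> exists Q, forall w, Q <= `|zden R w| -> rho - d <= quality N x w) ->
  (forall d Q, 0 < d -> exists w, Q <= `|zden R w| /\ quality N x w <= rho + d) ->
  liminf_torus N x = rho%:E.
Proof.
move=> low up; apply: limn_einf_fin_eq => [d d0|d Q d0].
  have [Q lowQ] := low d d0; exists (Num.truncn Q).+1 => q Qq.
  have [w [wq ->]] := torus_quality x q; apply: lowQ; rewrite wq ger0_norm ?ler0n//.
  apply: le_trans (_ : (Num.truncn Q).+1%:R <= _); first exact/ltW/truncnS_gt.
  by rewrite ler_nat.
have [w [Qw Fw]] := up d Q%:R d0; have [q [qw Fq]] := quality_torus x w.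
exists q; split; last exact: le_trans Fw.
by rewrite -(ler_nat R) qw.
Qed.

Lemma rational_torus_norm0 (x : V) : Q2 x ->
  forall Q : nat, exists q, (Q <= q)%N /\ torus_norm N (q%:R *: x) = 0.
Proof.
move=> [r _ <-] Q.
pose D : nat := (`|denq (r ord0 0%R)| * `|denq (r ord0 1%R)|)%N.
have D0 : (0 < D)%N by rewrite muln_gt0 !absz_gt0 !denq_neq0.
exists (Q * D)%N; split; first by rewrite leq_pmulr.
have [p1 _ [-> le_p]] := torus_norm_min ((Q * D)%:R *: map_mx ratr r) normN.
have int_j j : exists m : int, D%:R * ratr (r ord0 j) = m%:~R :> R.
  have den0 : (denq (r ord0 j))%:~R != 0 :> R by rewrite intr_eq0 denq_neq0.
  have [e De] : exists e : int, D%:R = (denq (r ord0 j))%:~R * e%:~R :> R.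
    have dvdD : (denq (r ord0 j) %| D%:Z)%Z.
      rewrite dvdzE /= /D.
      have [->|->] : j = 0 \/ j = 1.
        by case: j {den0} => [[|[|//]] lt]; [left|right]; apply: val_inj.
      - exact: dvdn_mulr.
      - exact: dvdn_mull.
    have /dvdzP[e De] := dvdD; exists e.
    by rewrite -intrM mulrC -De.
  exists (e * numq (r ord0 j)); rewrite De intrM /ratr.
  by field.
apply/eqP; rewrite eq_le is_norm_ge0// andbT.
have [m0 e0] := int_j 0; have [m1 e1] := int_j 1.
pose z := \row_(j < 2) (Q%:Z * (if j == 0 then m0 else m1)) : 'rV[int]_2.
have /le_p := (imageT (fun z : 'rV[int]_2 => map_mx (intr : int -> R) z) z : Z2 _).
suff -> : (Q * D)%:R *: map_mx ratr r = map_mx intr z :> V.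
  by rewrite subrr is_norm0.
apply/rowP => j; rewrite !mxE natrM -mulrA.
have [->|->] : j = 0 \/ j = 1.
  by case: j => [[|[|//]] lt]; [left|right]; apply: val_inj.
- by rewrite eqxx intrM e0.
- by rewrite /= intrM e1.
Qed.

Lemma liminf_torus_gt0_irrational (x : V) (rho : R) : 0 < rho ->
  (forall d, 0 < d -> exists Q, forall w, Q <= `|zden R w| -> rho - d <= quality N x w) ->
  ~ Q2 x.
Proof.
move=> rho0 low /rational_torus_norm0 xQ.
have d0 : 0 < rho / 2 by rewrite divr_gt0.
have [Q lowQ] := low _ d0; have [q [Qq tq]] := xQ (Num.truncn Q).+1.
have [w [wq]] := torus_quality x q; rewrite tq mulr0 => F0.
have : rho - rho / 2 <= quality N x w.
  apply: lowQ; rewrite wq ger0_norm ?ler0n//.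
  by apply: le_trans (ltW (truncnS_gt Q)) _; rewrite ler_nat.
rewrite -F0; lra.
Qed.

Lemma spectrum_of_liminf (rho0 : R) : 0 < rho0 ->
  (forall rho : R, 0 < rho < rho0 ->
    exists x : V, liminf_torus N x = rho%:E) ->
  [set y%:E | y in `]rho0^-1, +oo[] `<=` Lagrange_spectrum2 N.
Proof.
move=> rho00 h _ [y /= + <-]; rewrite in_itv /= andbT => y0.
have yp : 0 < y by apply: lt_trans y0; rewrite invr_gt0.
have [|x xP] := h y^-1.
  by rewrite invr_gt0 yp/= invf_plt ?posrE.
by exists x => //; rewrite xP inver invr_eq0 gt_eqF// invrK.
Qed.

End Liminf.

(** * Planning a path of bases with prescribed infimum of costs *)

Section Path.
Variable R : realType.
Local Notation V := 'rV[R]_2.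
Variable N : V -> R.
Hypothesis normN : is_norm N.
Local Notation sqrt3 := (Num.sqrt (3 : R)).
Local Notation psi := (@psi R).
Local Notation zeta_re := (@zeta_re R).
Local Notation zeta_im := (@zeta_im R).
Local Notation zeta_abs := (@zeta_abs R).
Local Notation past_limit := (@past_limit R).
Local Notation frame_norm := (frame_norm N).
Local Notation basis_dist := (basis_dist N).
Implicit Types (A B v : V * V) (q : R * R).

(** The limit of the quality of M w when the powers of the unit next to M are
    long, M having basis A. *)
Definition cost A (w : Z3) : R := Num.sqrt (past_limit w) * frame_norm A (zeta_re w)
  (zeta_im w).

Definition bounded_by (l u : R) A :=
  forall x y, l * hypot x y <= frame_norm A x y <= u * hypot x y.

Lemma hypot_rotate q x y : q.1 ^+ 2 + q.2 ^+ 2 = 1 ->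
  hypot (q.1 * x - q.2 * y) (q.2 * x + q.1 * y) = hypot x y.
Proof.
move=> q1; rewrite /hypot; congr Num.sqrt.
transitivity ((q.1 ^+ 2 + q.2 ^+ 2) * (x ^+ 2 + y ^+ 2)); first by ring.
by rewrite q1 mul1r.
Qed.

Lemma bounded_rot l u q A : q.1 ^+ 2 + q.2 ^+ 2 = 1 ->
  bounded_by l u A -> bounded_by l u (rotate q A).
Proof. by move=> q1 h x y; rewrite frame_norm_rotate -(hypot_rotate x y q1); exact: h. Qed.

Lemma frame_norm_limit_step q A x y : frame_norm (limit_step q A) x y =
  frame_norm (rotate q A) (- sqrt3 * x) (sqrt3^-1 * y).
Proof. by congr N; rewrite /comb /limit_step /= !scalerA ![_ * x]mulrC ![_ * y]mulrC. Qed.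

Lemma bounded_limit_step l u q A : 0 <= l -> 0 <= u -> q.1 ^+ 2 + q.2 ^+ 2 = 1 ->
  bounded_by l u A -> bounded_by (l / 2) (2 * u) (limit_step q A).
Proof.
move=> l0 u0 q1 h x y; rewrite frame_norm_limit_step.
have /andP[h1 h2] := bounded_rot q1 h (- sqrt3 * x) (sqrt3^-1 * y).
have a0 := hypot_ge0 x y.
have i3 : sqrt3^-1 ^+ 2 = 3^-1 by rewrite exprVn sqrt3_sqr.
have sq : hypot (- sqrt3 * x) (sqrt3^-1 * y) ^+ 2 = 3 * x ^+ 2 + 3^-1 * y ^+ 2.
  by rewrite hypot_sqr !exprMn sqrrN sqrt3_sqr i3.
have := hypot_sqr x y; have x0 := sqr_ge0 x; have y0 := sqr_ge0 y => sq'.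
have b1 : hypot (- sqrt3 * x) (sqrt3^-1 * y) <= 2 * hypot x y.
  rewrite -(ler_pXn2r (n:=2)) ?nnegrE ?mulr_ge0 ?hypot_ge0//.
  rewrite sq exprMn sq'; lra.
have b2 : hypot x y / 2 <= hypot (- sqrt3 * x) (sqrt3^-1 * y).
  rewrite -(ler_pXn2r (n:=2)) ?nnegrE ?divr_ge0 ?hypot_ge0//.
  rewrite sq expr_div_n sq'; lra.
apply/andP; split.
  by apply: le_trans h1; rewrite -mulrA ler_wpM2l// mulrC.
by apply: le_trans h2 _; rewrite [2 * u]mulrC -mulrA ler_wpM2l.
Qed.

Lemma bounded_dist l u A B d : basis_dist B A <= d -> bounded_by l u A ->
  bounded_by (l - d) (u + d) B.
Proof.
move=> dd h x y; have /andP[h1 h2] := h x y.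
have e1 := frame_norm_dist normN A B x y; have e2 := frame_norm_dist normN B A x y.
rewrite basis_distC// in e1.
have : basis_dist B A * hypot x y <= d * hypot x y by rewrite ler_wpM2r ?hypot_ge0.
by rewrite mulrBl [(u + d) * _]mulrDl => e3; apply/andP; split; lra.
Qed.

Lemma bounded_basis_size l u A : bounded_by l u A -> basis_size N A <= 2 * u.
Proof.
move=> h; have /andP[_] := h 1 0; have /andP[_] := h 0 1.
rewrite /frame_norm /comb /hypot !scale1r !scale0r addr0 add0r !expr1n expr0n /= addr0
  add0r.
rewrite sqrtr1 /basis_size; lra.
Qed.

Lemma cost_ge A w l u : 0 <= l -> bounded_by l u A -> w != (0, 0, 0) -> l / 5 <= cost A w.
Proof.
move=> l0 h w0; have /andP[h1 _] := h (zeta_re w) (zeta_im w).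
have gz := past_limit_zeta R w0.
have g0 : 0 <= past_limit w by exact: normr_ge0.
apply: le_trans (_ : Num.sqrt (past_limit w) * (l * zeta_abs w) <= _); last first.
  by rewrite ler_wpM2l ?sqrtr_ge0.
rewrite mulrCA ler_wpM2l//.
have -> : Num.sqrt (past_limit w) * zeta_abs w = Num.sqrt (past_limit w * zeta_abs w ^+ 2).
  by rewrite sqrtrM// sqrtr_sqr ger0_norm ?zeta_abs_ge0.
have -> : 5^-1 = Num.sqrt (5^-1 ^+ 2) :> R by rewrite sqrtr_sqr ger0_norm.
by apply: ler_wsqrtr; apply: le_trans gz; rewrite expr2; lra.
Qed.

(** Costs depend on the basis in a Lipschitz way, uniformly in w on the
    logarithmic scale; this makes infima over w continuous. *)
Lemma cost_dist A B w l u d : 0 < l -> bounded_by l u A -> basis_dist B A <= d * l ->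
  (1 - d) * cost A w <= cost B w <= (1 + d) * cost A w.
Proof.
move=> l0 h dd.
have e1 := frame_norm_dist normN A B (zeta_re w) (zeta_im w);
  have e2 := frame_norm_dist normN B A (zeta_re w) (zeta_im w).
rewrite basis_distC// in e1.
have /andP[h1 _] := h (zeta_re w) (zeta_im w).
have d0 : 0 <= d by rewrite -(pmulr_lge0 _ l0); apply: le_trans dd; exact: basis_dist_ge0.
have e3 : basis_dist B A * hypot (zeta_re w) (zeta_im w) <=
  d * frame_norm A (zeta_re w) (zeta_im w).
  apply: le_trans (_ : d * l * hypot (zeta_re w) (zeta_im w) <= _).
    by rewrite ler_wpM2r ?hypot_ge0.
  by rewrite -mulrA ler_wpM2l.
rewrite /cost (mulrCA (1 - d)) (mulrCA (1 + d)).
by apply/andP; split; apply: ler_wpM2l; rewrite ?sqrtr_ge0//; lra.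
Qed.

(** The rotations of the planned path: j times the rotation (c, s); then a
    quarter turn, which undoes the last step by [limit_step_back]; then j - 1
    times the rotation (- c, s), which undoes the others. *)
Definition turn (j : nat) (c : R) (i : nat) : R * R :=
  if (i < j)%N then (c, Num.sqrt (1 - c ^+ 2))
  else if i == j then (0, 1) else (- c, Num.sqrt (1 - c ^+ 2)).

Fixpoint planned j c A i : V * V :=
  if i is i'.+1 then limit_step (turn j c i') (planned j c A i') else A.

Lemma turn_unit j c i : 0 <= c <= 1 -> (turn j c i).1 ^+ 2 + (turn j c i).2 ^+ 2 = 1.
Proof.
move=> /andP[c0 c1]; have c2 : 0 <= 1 - c ^+ 2 by rewrite subr_ge0 exprn_ile1.
by rewrite /turn; case: ifP => _; last case: ifP => _; rewrite /= ?sqrrN ?sqr_sqrtr//; ring.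
Qed.

Lemma planned_bounded j c A l u i : 0 <= l -> 0 <= u -> 0 <= c <= 1 -> bounded_by l u A ->
  bounded_by (l / 2 ^+ i) (2 ^+ i * u) (planned j c A i).
Proof.
move=> l0 u0 c01 h; elim: i => [|i IHi] /=; first by rewrite expr0 divr1 mul1r.
have -> : l / 2 ^+ i.+1 = l / 2 ^+ i / 2 by rewrite exprSr invfM mulrA.
have -> : 2 ^+ i.+1 * u = 2 * (2 ^+ i * u) by rewrite exprS mulrA.
apply: bounded_limit_step => //; last exact: turn_unit.
  by rewrite divr_ge0// exprn_ge0.
by rewrite mulr_ge0// exprn_ge0.
Qed.

(** With w the quarter turn, h w h = - w since det h = -1; so a step followed by a
    quarter turn and another h is undone, up to a rotation. *)
Lemma limit_step_back c s A : limit_step (0, 1) (limit_step (c, s) A) = rotate (s, - c) A.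
Proof.
have s30 : sqrt3 != 0 by rewrite gt_eqF// sqrt3_gt0.
by congr pair; apply/rowP => j; rewrite !mxE /=; field.
Qed.

Lemma limit_step_retrace c s B : s ^+ 2 + c ^+ 2 = 1 ->
  limit_step (- c, s) (rotate (s, - c) (limit_step (c, s) B)) = rotate (s, - c) B.
Proof.
move=> sc; rewrite -[RHS]limit_step_back; move: (limit_step (c, s) B) => D.
suff h : rotate (- c, s) (rotate (s, - c) D) = rotate (0, 1) D by rewrite /limit_step h.
by congr pair; apply/rowP => j; rewrite !mxE /=;
  rewrite -[in RHS]sc; ring.
Qed.

Lemma rotate1 A : rotate (1, 0) A = A.
Proof. by case: A => a b; rewrite /rotate /= !scale1r oppr0 !scale0r addr0 add0r. Qed.

(** The second half of the path visits the bases of the first half in reverse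
    order, turned by a fixed rotation. *)
Lemma planned_return j c A i : 0 <= c <= 1 -> (i < j)%N ->
  planned j c A (j + i.+1) = rotate (Num.sqrt (1 - c ^+ 2), - c) (planned j c A (j - i.+1)).
Proof.
move=> /andP[c0 c1]; have c2 : 0 <= 1 - c ^+ 2 by rewrite subr_ge0 exprn_ile1.
elim: i => [|i IHi] lt_ij.
  rewrite addn1 /= {1}/turn ltnn eqxx.
  case: j lt_ij => // j _; rewrite subn1 /= {1}/turn ltnSn.
  exact: limit_step_back.
rewrite addnS /= IHi; last exact: ltnW.
rewrite {1}/turn ifN; last by rewrite -leqNgt leq_addr.
rewrite ifN; last by rewrite -{2}[j]addn0 eqn_add2l.
have -> : (j - i.+1 = (j - i.+2).+1)%N by rewrite subnSK.
rewrite /= {1}/turn ifT; last by rewrite ltn_subrL; case: (j) lt_ij.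
by rewrite limit_step_retrace// sqr_sqrtr//; ring.
Qed.

Lemma planned_end j c A : 0 <= c <= 1 -> (0 < j)%N ->
  planned j c A (j + j) = rotate (Num.sqrt (1 - c ^+ 2), - c) A.
Proof.
move=> c01; case: j => // j _; rewrite planned_return//; by rewrite subnn.
Qed.

(** With c = 0 consecutive steps cancel, so the path stays within one step of its
    start whatever j is. *)
Lemma planned_fold j A i : planned j 0 A i = if odd i then limit_step (0, 1) A else A.
Proof.
have turn0 k : turn j 0 k = (0, 1).
  by rewrite /turn oppr0 expr0n /= subr0 sqrtr1; case: ifP => //; case: ifP.
elim: i => //= i ->; rewrite turn0; case: odd => //=.
by rewrite limit_step_back oppr0 rotate1.
Qed.

(** With c = 1 the steps add up to a power of h. *)
Lemma planned_straight j A i : (i <= j)%N -> (planned j 1 A i).2 = sqrt3^-1 ^+ i *: A.2.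
Proof.
elim: i => [|i IHi] lt_ij; first by rewrite expr0 scale1r.
rewrite /= /turn lt_ij /limit_step /rotate /= expr1n subrr sqrtr0 oppr0 scale0r scale1r
  add0r.
by rewrite IHi ?(ltnW lt_ij)// scalerA exprS.
Qed.

(** Pairs of a stage of the path and a nonzero vector.  The initial basis is left
    out: in the construction it is the last one of the preceding path. *)
Definition path_costs j A c :=
  [set cost (planned j c A p.1) p.2 | p in
    [set p : nat * Z3 | (0 < p.1 <= j + j)%N /\ p.2 != (0, 0, 0)]].

Definition path_inf j A c := inf (path_costs j A c).

Lemma path_costs_ge0 j A c x : path_costs j A c x -> 0 <= x.
Proof. by move=> [p _ <-]; rewrite mulr_ge0 ?sqrtr_ge0 ?is_norm_ge0. Qed.

Lemma path_costs_neq0 j A c : (0 < j)%N -> path_costs j A c !=set0.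
Proof.
move=> j0; exists (cost (planned j c A 1) (0, 0, 1)); exists (1%N, (0, 0, 1)) => //=.
by split=> //; rewrite addn_gt0 j0.
Qed.

Lemma path_inf_le j A c i w : (0 < i <= j + j)%N -> w != (0, 0, 0) ->
  path_inf j A c <= cost (planned j c A i) w.
Proof.
move=> ij w0; apply: ge_inf; last by exists (i, w).
by exists 0 => x; exact: path_costs_ge0.
Qed.

Lemma path_inf_ge j A c b : (0 < j)%N ->
  (forall i w, (0 < i <= j + j)%N -> w != (0, 0, 0) -> b <= cost (planned j c A i) w) ->
  b <= path_inf j A c.
Proof.
move=> j0 h; apply: lb_le_inf; first exact: path_costs_neq0.
by move=> _ [[i w] [/= h1 h2] <-]; exact: h.
Qed.

Lemma sqrt_circle_near (c0 e : R) : 0 < e -> exists2 d, 0 < d & forall c, `|c - c0| < d ->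
  `|Num.sqrt (1 - c ^+ 2) - Num.sqrt (1 - c0 ^+ 2)| <= e.
Proof.
move=> e0.
have cs : (fun c : R => Num.sqrt (1 - c ^+ 2)) @ c0 --> Num.sqrt (1 - c0 ^+ 2).
  apply: (@cvg_comp _ _ _ (fun c : R => 1 - c ^+ 2) Num.sqrt _ (nbhs (1 - c0 ^+ 2))).
    apply: cvgB; first exact: cvg_cst.
    exact: exprn_continuous.
  exact: sqrt_continuous.
have /(@cvgrPdist_le _ _ _ (nbhs c0))/(_ _ e0)/nbhs_ballP[d d0 hd] := cs.
exists d => // c cd; rewrite distrC; apply: hd.
by rewrite -ball_normE /= distrC.
Qed.

Lemma planned_near j A c0 i d : 0 < d -> 0 <= c0 <= 1 ->
  exists2 e, 0 < e & forall c, 0 <= c <= 1 -> `|c - c0| < e ->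
    forall k, (k <= i)%N -> basis_dist (planned j c A k) (planned j c0 A k) <= d.
Proof.
move=> d0 c01; elim: i d d0 => [|i IHi] d d0.
  exists 1 => // c _ _ k; rewrite leqn0 => /eqP -> /=.
  by rewrite /basis_dist !subrr !is_norm0// addr0 ltW.
set S := basis_size N (planned j c0 A i); have S0 : 0 <= S by exact: basis_size_ge0.
have S1 : 0 < 1 + S by rewrite ltr_pwDl.
pose e1 := d / (6 * (1 + S)); have e10 : 0 < e1 by rewrite divr_gt0// mulr_gt0.
have [ea ea0 ha] := IHi (d / 6) (divr_gt0 d0 (ltr0n _ 6)).
have [eb eb0 hb] := sqrt_circle_near c0 e10.
exists (Num.min (Num.min ea eb) e1); first by rewrite !lt_min ea0 eb0.
move=> c cc; rewrite !lt_min => /andP[/andP[cea ceb] ce1] k.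
rewrite leq_eqVlt => /orP[/eqP ->|]; last first.
  by rewrite ltnS => ki; apply: le_trans (ha c cc cea k ki) _; lra.
have Hi := ha c cc cea i (leqnn i).
have := limit_step_dist normN (planned j c A i) (planned j c0 A i) (turn_unit j i cc)
  (_ : `|(turn j c i).1 - (turn j c0 i).1| <= e1)
  (_ : `|(turn j c i).2 - (turn j c0 i).2| <= e1).
have t1 : `|(turn j c i).1 - (turn j c0 i).1| <= e1.
  rewrite /turn; case: ifP => _ /=; first exact: ltW.
  case: ifP => _ /=; first by rewrite subrr normr0 ltW.
  by rewrite -opprD normrN; exact: ltW.
have t2 : `|(turn j c i).2 - (turn j c0 i).2| <= e1.
  rewrite /turn; case: ifP => _ /=; first exact: hb.
  case: ifP => _ /=; first by rewrite subrr normr0 ltW.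
  exact: hb.
move=> /(_ t1 t2) /=.
have : e1 * S <= d / 6.
  have -> : d / 6 = e1 * (1 + S) by rewrite /e1; field; rewrite gt_eqF.
  by rewrite ler_wpM2l ?(ltW e10)// lerDr.
rewrite -/S; lra.
Qed.

Lemma path_inf_dist j A c c0 l u d : (0 < j)%N -> 0 < l -> 0 <= u -> 0 <= c0 <= 1 ->
  0 <= d <= 1 -> bounded_by l u A ->
  (forall k, (k <= j + j)%N ->
    basis_dist (planned j c A k) (planned j c0 A k) <= d * (l / 2 ^+ (j + j))) ->
  `|path_inf j A c - path_inf j A c0| <= d * path_inf j A c0.
Proof.
move=> j0 l0 u0 c01 /andP[d0 d1] hA hd.
have cd k w : (k <= j + j)%N ->
   (1 - d) * cost (planned j c0 A k) w <= cost (planned j c A k) w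
     <= (1 + d) * cost (planned j c0 A k) w.
  move=> kj; apply: (cost_dist _ _ (planned_bounded j k (ltW l0) u0 c01 hA)).
    by rewrite divr_gt0// exprn_gt0.
  apply: le_trans (hd k kj) _; rewrite ler_wpM2l// ler_wpM2l ?(ltW l0)//.
  by rewrite lef_pV2 ?posrE ?exprn_gt0// ler_weXn2l// ler1n.
rewrite ler_norml; apply/andP; split.
  rewrite lerBrDr; apply: le_trans (_ : (1 - d) * path_inf j A c0 <= _); first lra.
  apply: path_inf_ge => // i w ij w0; have /andP[_ i2] := ij.
  have /andP[h1 _] := cd i w i2; apply: le_trans h1.
  by rewrite ler_wpM2l ?subr_ge0// path_inf_le.
rewrite lerBlDr -[X in _ + X]mul1r -mulrDl addrC.
rewrite -ler_pdivrMl; last by lra.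
apply: path_inf_ge => // i w ij w0; have /andP[_ i2] := ij.
rewrite ler_pdivrMl; last by lra.
by have /andP[_ h1] := cd i w i2; apply: le_trans h1; rewrite path_inf_le.
Qed.

Lemma path_inf_continuous j A l u : (0 < j)%N -> 0 < l -> 0 <= u ->
  bounded_by l u A -> {within `[0, 1], continuous (path_inf j A)}.
Proof.
move=> j0 l0 u0 hA; apply/subspace_continuousP => c0 /=; rewrite in_itv /= => c01.
apply/cvgrPdist_le => e e0.
set f0 := path_inf j A c0.
have f00 : 0 <= f0 by apply: path_inf_ge => // i w _ _;
  rewrite mulr_ge0 ?sqrtr_ge0 ?is_norm_ge0.
pose d := Num.min 1 (e / (1 + f0)).
have d01 : 0 < d <= 1.
  by rewrite lt_min ltr01 divr_gt0 ?ltr_pwDl// /= ge_min lexx.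
have /andP[d0 d1] := d01.
have dl : 0 < d * (l / 2 ^+ (j + j)) by rewrite mulr_gt0// divr_gt0// exprn_gt0.
have [eta eta0 heta] := planned_near j A (j + j) dl c01.
apply/nbhs_ballP; exists eta => //= c; rewrite -ball_normE /= distrC => cc.
rewrite in_itv /= => c01'.
rewrite distrC; apply: le_trans (path_inf_dist j0 l0 u0 c01 _ hA (heta c c01' cc)) _.
  by rewrite (ltW d0).
rewrite -/f0; apply: le_trans (_ : d * (1 + f0) <= _).
  by rewrite ler_wpM2l ?(ltW d0)// lerDr.
by rewrite -ler_pdivlMr ?ltr_pwDl// ge_min lexx orbT.
Qed.

Lemma straight_small (B rho : R) : 0 <= B -> 0 < rho ->
  exists j, B * sqrt3^-1 ^+ j <= rho.
Proof.
move=> B0 rho0; have [s31 _] := sqrt3_bounds R.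
have [j jB] := expn2_unbounded (B / rho); exists (j + j)%N.
have i3 : sqrt3^-1 ^+ 2 = 3^-1 by rewrite exprVn sqrt3_sqr.
rewrite addnn -muln2 mulnC exprM i3 exprVn ler_pdivrMr ?exprn_gt0//.
rewrite -ler_pdivrMl// mulrC; apply: le_trans (ltW jB) _.
by rewrite lerXn2r ?nnegrE// ler_nat.
Qed.

(** Intermediate value theorem between the folded path, whose costs are at
    least l / 10, and the straight one, where the cost at t^2 = (0, 0, 1) is at most rho for
    large j: this vector has zeta real, and on the way back the quarter turn
    exposes it to the contracting direction of a power of h. *)
Lemma exact_plan u rho : 0 <= u -> 0 < rho -> exists2 j, (0 < j)%N &
  forall l A, 0 < l -> bounded_by l u A -> rho <= l / 10 ->
  exists2 c, 0 <= c <= 1 &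
    (forall i w, (0 < i <= j + j)%N -> w != (0, 0, 0) ->
      rho <= cost (planned j c A i) w) /\
    (forall d, 0 < d -> exists i w, [/\ (0 < i <= j + j)%N, w != (0, 0, 0) &
      cost (planned j c A i) w < rho + d]).
Proof.
move=> u0 rho0.
have [w1 [w10 zy1]] : exists w1, w1 != (0, 0, 0) /\ zeta_im w1 = 0.
  by exists (0, 0, 1); split=> //; rewrite /zeta_im; ring.
have B0 : 0 <= Num.sqrt (past_limit w1) * (`|zeta_re w1| * u)
  by rewrite !mulr_ge0 ?sqrtr_ge0.
have [j hj] := straight_small B0 rho0.
exists j.+1 => // l A l0 hA rl.
have f0 : rho <= path_inf j.+1 A 0.
  apply: path_inf_ge => // i w _ w0.
  have h2 : bounded_by (l / 2) (2 * u) (limit_step (0, 1) A).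
    by apply: bounded_limit_step (ltW l0) u0 _ hA; rewrite /= expr0n expr1n add0r.
  apply: le_trans rl _; have -> : l / 10 = l / 2 / 5 by field.
  rewrite planned_fold; case: odd.
    by apply: cost_ge h2 w0; rewrite divr_ge0// ltW.
  apply: le_trans (cost_ge (ltW l0) hA w0); lra.
have f1 : path_inf j.+1 A 1 <= rho.
  have ij : (0 < j.+1 + 1 <= j.+1 + j.+1)%N by rewrite addn1 /= -addn1 leq_add2l.
  apply: le_trans (path_inf_le A 1 ij w10) _; apply: le_trans hj.
  rewrite planned_return//; last by rewrite ler01 lexx.
  rewrite /cost zy1 frame_norm_rotate /= expr1n subrr sqrtr0.
  rewrite !mulr0 subr0 addr0 mul0r mulN1r subn1 /=.
  rewrite -!mulrA; apply: ler_wpM2l; rewrite ?sqrtr_ge0//.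
  rewrite /frame_norm /comb scale0r add0r planned_straight//.
  rewrite !is_norm_scale// normrN; apply: ler_wpM2l => //.
  rewrite ger0_norm ?exprn_ge0 ?invr_ge0 ?sqrtr_ge0// mulrC.
  apply: ler_wpM2r; first by rewrite exprn_ge0// invr_ge0 sqrtr_ge0.
  have /andP[_] := hA 0 1.
  by rewrite /frame_norm /comb /hypot scale0r scale1r add0r expr1n expr0n add0r sqrtr1
    mulr1.
have mid : Num.min (path_inf j.+1 A 0) (path_inf j.+1 A 1) <= rho
    <= Num.max (path_inf j.+1 A 0) (path_inf j.+1 A 1).
  by rewrite ge_min f1 orbT le_max f0.
have [c c01 fc] := IVT ler01 (path_inf_continuous (ltn0Sn j) l0 u0 hA) mid.
rewrite in_itv /= in c01; exists c => //; split.
  by move=> i w ij w0; rewrite -fc path_inf_le.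
move=> d d0.
have lt_inf : inf (path_costs j.+1 A c) < rho + d.
  by rewrite -/(path_inf j.+1 A c) fc ltrDl.
have hi : has_inf (path_costs j.+1 A c).
  split; first exact: path_costs_neq0.
  by exists 0 => x; exact: path_costs_ge0.
have [_ [[i w] [/= ij w0] <-]] := inf_adherent d0 hi.
by rewrite -/(path_inf j.+1 A c) fc => lt; exists i, w.
Qed.

End Path.

(** * Following a plan with large exponents *)

Section Construction.
Variable R : realType.
Local Notation V := 'rV[R]_2.
Variable N : V -> R.
Hypothesis normN : is_norm N.
Local Notation psi := (@psi R).
Local Notation zeta_re := (@zeta_re R).
Local Notation zeta_im := (@zeta_im R).
Local Notation zeta_abs := (@zeta_abs R).
Local Notation past_limit := (@past_limit R).
Local Notation frame_norm := (frame_norm N).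
Local Notation basis_dist := (basis_dist N).
Local Notation cost := (cost N).
Local Notation bounded_by := (bounded_by N).
Local Notation sigma := (sigma R).
Local Notation eps n := (sigma ^+ n ^+ 3).
Local Notation frame := (frame R).
Implicit Types (A B v : V * V) (q : R * R).

Lemma sigma_pow_small e : 0 < e -> exists n0, forall n, (n0 <= n)%N -> sigma ^+ n <= e.
Proof.
move=> e0.
have s0 := sigma_gt0 R; have s1 := sigma_lt1 R.
have : `|sigma| < 1 by rewrite gtr0_norm.
move=> /cvg_expr /(@cvgrPdist_le _ _ _ \oo) /(_ e e0) [n0 _ h].
exists n0 => n /h /=; rewrite sub0r normrN ger0_norm// exprn_ge0//; exact: ltW.
Qed.

Lemma eps_le n : eps n <= sigma ^+ n.
Proof.
have s0 := sigma_gt0 R; have s1 := sigma_lt1 R.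
have t0 := sigman_gt0 R n.
have t1 : sigma ^+ n <= 1 by rewrite exprn_ile1// ltW.
by rewrite exprSr ler_piMl ?(ltW t0)// exprn_ile1// ltW.
Qed.

Lemma eps_anti m n : (m <= n)%N -> eps n <= eps m.
Proof.
move=> mn; have s0 := sigma_gt0 R; have s1 := sigma_lt1 R.
rewrite lerXn2r ?nnegrE ?exprn_ge0 ?(ltW s0)//.
by apply: ler_wiXn2l => //; exact: ltW.
Qed.

Lemma basis_dist_triangle A B v : basis_dist A v <= basis_dist A B + basis_dist B v.
Proof.
rewrite /basis_dist addrACA; apply: lerD.
  by rewrite -[A.1 - v.1](subrKA B.1); exact: is_norm_triangle.
by rewrite -[A.2 - v.2](subrKA B.2); exact: is_norm_triangle.
Qed.

Lemma step_approx (f : frame) A q tau n0 : frame_ok f -> q.1 ^+ 2 + q.2 ^+ 2 = 1 ->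
  0 < tau ->
  exists n, [/\ (n0 <= n)%N, sigma ^+ n <= 1 / 10 &
    basis_dist (fbasis (step n f)) (limit_step q A) <= 3 * basis_dist (fbasis f) A + tau].
Proof.
move=> fo q1 tau0.
have S0 := basis_size_ge0 normN (fbasis f); have S1 := basis_size_ge0 normN A.
have S10 : 0 < 1 + basis_size N (fbasis f) by rewrite ltr_pwDl.
have [e [e10 eE]] : exists e, 0 < e /\ 300 * e * (1 + basis_size N (fbasis f)) = tau / 2.
  exists (tau / 2 / (1 + basis_size N (fbasis f)) / 300); split.
    by rewrite divr_gt0 ?ltr0n// divr_gt0// divr_gt0.
  by field; rewrite gt_eqF.
have e20 : 0 < 1 / 10 :> R by rewrite divr_gt0.
have [n1 hn1] := sigma_pow_small e10.
have [n2 hn2] := sigma_pow_small e20.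
have d0 : 0 < tau / (6 * (1 + basis_size N A)) by rewrite divr_gt0// mulr_gt0// ltr_pwDl.
have [n [nn q1n q2n]] := rotn_dense (maxn n0 (maxn n1 n2)) q1 d0.
rewrite !geq_max in nn; have /and3P[nn0 nn1 nn2] := nn.
exists n; split=> //; first exact: hn2.
apply: le_trans (basis_dist_triangle _ (limit_step (rotn R n) (fbasis f)) _) _.
have h1 := step_fbasis normN fo (hn2 _ nn2).
have h2 := limit_step_dist normN (fbasis f) A (rotn_unit R n) q1n q2n.
have h3 : 300 * eps n * basis_size N (fbasis f) <= tau / 2.
  rewrite -eE; apply: ler_pM; last by rewrite lerDr.
  - by rewrite mulr_ge0 ?ler0n// ltW// eps_ge0.
  - exact: S0.
  - by rewrite ler_wpM2l ?ler0n//; apply: le_trans (eps_le n) _; exact: hn1.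
have h4 : 3 * (tau / (6 * (1 + basis_size N A))) * basis_size N A <= tau / 2.
  apply: le_trans (_ : 3 * (tau / (6 * (1 + basis_size N A))) * (1 + basis_size N A) <= _).
    by rewrite ler_wpM2l ?lerDr// mulr_ge0// ltW.
  by rewrite le_eqVlt; apply/orP; left; apply/eqP; field; rewrite gt_eqF// ltr_pwDl.
lra.
Qed.

Fixpoint run (ns : nat -> nat) (f : frame) i : frame :=
  if i is i'.+1 then step (ns i') (run ns f i') else f.

Lemma run_ok ns f i : frame_ok f -> (forall i, sigma ^+ ns i <= 1 / 10) ->
  frame_ok (run ns f i).
Proof. by move=> fo h; elim: i => //= i IHi; exact: step_ok. Qed.

(** Steps are 3-Lipschitz, so errors grow at most by a factor 4 per step once each
    single step is made with error eta / 4^J. *)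
Lemma follow_path (f : frame) j c n0 eta J : frame_ok f -> 0 <= c <= 1 -> 0 < eta ->
  exists ns, [/\ forall i, (n0 <= ns i)%N, forall i, sigma ^+ ns i <= 1 / 10 &
    forall i, (i <= J)%N -> basis_dist (fbasis (run ns f i)) (planned j c (fbasis f) i)
      <= eta].
Proof.
move=> fo c01 eta0; pose tau := eta / 4 ^+ J.
have tau0 : 0 < tau by rewrite divr_gt0// exprn_gt0.
have /choice[g gP] : forall p : frame * nat, exists n, [/\ (n0 <= n)%N, sigma ^+ n <=
  1 / 10 &
   frame_ok p.1 -> basis_dist (fbasis (step n p.1)) (limit_step (turn j c p.2) (planned j
     c (fbasis f) p.2))
      <= 3 * basis_dist (fbasis p.1) (planned j c (fbasis f) p.2) + tau].
  move=> [f' i] /=; have [fo'|nfo'] := pselect (frame_ok f').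
    have [n [n1 n2 n3]] := step_approx (planned j c (fbasis f) i) n0 fo' (turn_unit j i
      c01) tau0.
    by exists n.
  have e20 : 0 < 1 / 10 :> R by rewrite divr_gt0.
  have [n1 hn1] := sigma_pow_small e20.
  exists (maxn n0 n1); split=> //; first exact: leq_maxl.
  by apply: hn1; exact: leq_maxr.
pose fs := fix fs i := if i is i'.+1 then step (g (fs i', i')) (fs i') else f.
pose ns i := g (fs i, i).
have fsE i : run ns f i = fs i by elim: i => //= i ->.
have ns10 i : sigma ^+ ns i <= 1 / 10 by have [] := gP (fs i, i).
exists ns; split=> // [i|i iJ]; first by have [] := gP (fs i, i).
apply: le_trans (_ : 4 ^+ i * tau <= _); last first.
  rewrite /tau mulrA ler_pdivrMr ?exprn_gt0// mulrC ler_wpM2l ?(ltW eta0)//.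
  by rewrite ler_weXn2l// ler1n.
elim: i {iJ} => [|i IHi].
  by rewrite /basis_dist !subrr !is_norm0// addr0 expr0 mul1r ltW.
have [_ _ h] := gP (fs i, i).
have fo_i : frame_ok (fs i) by rewrite -fsE; exact: run_ok.
rewrite fsE in IHi; rewrite /= fsE; apply: le_trans (h fo_i) _.
have p1 : tau <= 4 ^+ i * tau by rewrite ler_peMl ?(ltW tau0)// exprn_ege1// ler1n.
by rewrite exprS -mulrA; lra.
Qed.

Lemma perturb_small (G Vv Z P d : R) : 0 <= G -> 0 < d ->
  exists2 t, 0 < t & forall e, 0 <= e -> e <= t ->
    Num.sqrt (G + e * Z) * (Vv + e * P) <= Num.sqrt G * Vv + d.
Proof.
move=> G0 d0.
have fc : (fun e : R => Num.sqrt (G + e * Z) * (Vv + e * P)) @ (0 : R) -->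
    Num.sqrt (G + 0 * Z) * (Vv + 0 * P).
  apply: cvgM.
    apply: (@cvg_comp _ _ _ (fun e : R => G + e * Z) Num.sqrt _ (nbhs (G + 0 * Z))).
      by apply: cvgD; [exact: cvg_cst|apply: cvgM; [exact: cvg_id|exact: cvg_cst]].
    exact: sqrt_continuous.
  by apply: cvgD; [exact: cvg_cst|apply: cvgM; [exact: cvg_id|exact: cvg_cst]].
have /(@cvgrPdist_le _ _ _ (nbhs (0 : R)))/(_ _ d0)/nbhs_ballP[t t0 ht] := fc.
exists (t / 2); first by rewrite divr_gt0.
move=> e e0 et; have /ht /= : ball (0 : R) t e.
  rewrite -ball_normE /= sub0r normrN ger0_norm//; apply: le_lt_trans et _.
  by rewrite ltr_pdivrMr// ltr_pMr// ltr1n.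
by rewrite !mul0r !addr0 => /ler_normlP[h _]; lra.
Qed.

End Construction.

(** * One period, and the limit of infinitely many *)

Section Period.
Variable R : realType.
Local Notation V := 'rV[R]_2.
Variable N : V -> R.
Hypothesis normN : is_norm N.
Local Notation psi := (@psi R).
Local Notation zeta_re := (@zeta_re R).
Local Notation zeta_im := (@zeta_im R).
Local Notation zeta_abs := (@zeta_abs R).
Local Notation past_limit := (@past_limit R).
Local Notation frame_norm := (frame_norm N).
Local Notation basis_dist := (basis_dist N).
Local Notation cost := (cost N).
Local Notation bounded_by := (bounded_by N).
Local Notation sigma := (sigma R).
Local Notation eps n := (sigma ^+ n ^+ 3).
Local Notation frame := (frame R).
Implicit Types (A B v : V * V) (q : R * R).

Lemma bounded_weaken l u l' u' A : l' <= l -> u <= u' ->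
  bounded_by l u A -> bounded_by l' u' A.
Proof.
move=> ll uu h x y; have /andP[h1 h2] := h x y; apply/andP; split.
  by apply: le_trans h1; rewrite ler_wpM2r ?hypot_ge0.
by apply: le_trans h2 _; rewrite ler_wpM2r ?hypot_ge0.
Qed.

Lemma run_fscale ns (f : frame) i : frame_ok f -> (forall i, sigma ^+ ns i <= 1 / 10) ->
  fscale (run ns f 1) <= fscale (run ns f i.+1).
Proof.
move=> fo h; elim: i => // i IHi; apply: le_trans IHi _.
have := step_fscale (run_ok i.+1 fo h) (h i.+1).
have [y0 _ _] := run_ok i.+1 fo h; rewrite -[step _ _]/(run ns f i.+2); lra.
Qed.

Lemma step_fscale_big n (f : frame) : frame_ok f -> sigma ^+ n <= 1 / 10 ->
  fscale f ^+ 2 * (3 / 10) / sigma ^+ n <= fscale (step n f) ^+ 2.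
Proof.
move=> fo sn; have [/andP[d1 d2] _ _] := step_den_bounds fo sn.
have s0 := sigman_gt0 R n; have [y0 _ _] := fo.
have dp : 0 < step_den n f by lra.
rewrite step_fscale_sqr// -(mulrA _ (3 / 10)) -(mulrA _ (_ ^- 2)).
rewrite ler_wpM2l ?sqr_ge0// [leRHS]mulrC.
apply: ler_pM; rewrite ?invr_ge0 ?(ltW s0)//; first by lra.
rewrite lef_pV2 ?posrE ?exprn_gt0 ?sigma_gt0//.
by rewrite expr2 ger_pMl//; lra.
Qed.

(** Bounds for the basis at the beginning of period m; the drift allowed in that
    period is cN / 2^(m+2). *)
Definition low_bound (cN : R) m := cN / 2 + cN / 2 ^+ m.+1.
Definition upp_bound (cN CN : R) m := CN + cN - cN / 2 ^+ m.

(** A period plans an exact path from the present basis and follows it with errors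
    in the costs at most 1 / (m + 1).  The nearly minimizing vector w of the plan is known
    before the exponents are chosen, so these can be taken so large that the
    quality of w is close to its cost and that its denominator is at least m. *)
Lemma one_period cN CN rho : 0 < cN -> 0 <= CN -> 0 < rho -> rho <= cN / 20 ->
  exists J lmin U, [/\ (0 < J)%N, 0 < lmin & forall m (f : frame) n0, frame_ok f ->
    bounded_by (low_bound cN m) (upp_bound cN CN m) (fbasis f) ->
    exists ns n1, [/\ (n0 <= n1)%N, (m <= n1)%N,
      forall i, (n1 <= ns i)%N & forall i, sigma ^+ ns i <= 1 / 10] /\
      [/\ bounded_by (low_bound cN m.+1) (upp_bound cN CN m.+1) (fbasis (run ns f J)),
          forall i, (i <= J)%N -> bounded_by lmin U (fbasis (run ns f i)),
          forall i w, (0 < i <= J)%N -> w != (0, 0, 0) ->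
            rho - m.+1%:R^-1 <= cost (fbasis (run ns f i)) w &
          exists i w, [/\ (0 < i <= J)%N,
            m%:R <= fscale (run ns f i) ^+ 2 * `|past (run ns f i) w| &
            Num.sqrt `|past (run ns f i) w| * (frame_norm (fbasis (run ns f i)) (zeta_re
              w) (zeta_im w) +
              `|past (run ns f i) w| * (6 * (2 * U) * eps n1)) <= rho + m.+1%:R^-1]]].
Proof.
move=> cN0 CN0 rho0 rho_le.
have u0 : 0 <= CN + cN by rewrite addr_ge0// ltW.
have [j j0 hj] := exact_plan normN u0 rho0.
have J2 : 0 < 2 ^+ (j + j) :> R by rewrite exprn_gt0.
have [lid [lid0 lidE]] : exists l, 0 < l /\ l = cN / 2 / 2 ^+ (j + j).
  by exists (cN / 2 / 2 ^+ (j + j)); rewrite !divr_gt0.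
have [U [U0 UE]] : exists U, 0 <= U /\ U = 2 ^+ (j + j) * (CN + cN) + lid / 2.
  exists (2 ^+ (j + j) * (CN + cN) + lid / 2).
  by rewrite addr_ge0 ?mulr_ge0 ?divr_ge0 ?(ltW J2) ?(ltW lid0).
exists (j + j)%N, (lid / 2), U; split; first by rewrite addn_gt0 j0.
  by rewrite divr_gt0.
move=> m f n0 fo fb.
have pm : 0 < cN / 2 ^+ m.+1 by rewrite divr_gt0// exprn_gt0.
have lm : cN / 2 <= low_bound cN m by rewrite lerDl ltW.
have l0 : 0 < low_bound cN m by apply: lt_le_trans lm; rewrite divr_gt0.
have fb' : bounded_by (low_bound cN m) (CN + cN) (fbasis f).
  apply: bounded_weaken fb => //; rewrite /upp_bound gerBl.
  by rewrite divr_ge0 ?(ltW cN0)// exprn_ge0.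
have [|c c01 [hge hex]] := hj _ _ l0 fb'; first by lra.
have [dl dlE] : exists dl, dl = m.+1%:R^-1 :> R by eexists.
have dl0 : 0 < dl by rewrite dlE invr_gt0 ltr0n.
have dl1 : dl <= 1 by rewrite dlE invf_le1 ?ltr0n// ler1n.
rewrite -dlE.
have [i0 [w0 [ij w00 cost_lt]]] := hex _ (divr_gt0 dl0 (ltr0n R 2)).
have idb i : (i <= j + j)%N -> bounded_by lid (2 ^+ (j + j) * (CN
  + cN)) (planned j c (fbasis f) i).
  move=> iJ; apply: bounded_weaken (planned_bounded j i (ltW l0) u0 c01 fb').
    rewrite lidE; apply: ler_pM; rewrite ?divr_ge0 ?invr_ge0 ?(ltW cN0) ?(ltW J2)//.
    by rewrite lef_pV2 ?posrE ?exprn_gt0// ler_weXn2l// ler1n.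
  by rewrite ler_wpM2r// ler_weXn2l// ler1n.
set A0 := planned j c (fbasis f) i0 in cost_lt.
have G_0 : 0 <= past_limit w0 by exact: normr_ge0.
have Z0 : 0 <= zeta_abs w0 by exact: zeta_abs_ge0.
have G0 : 0 < past_limit w0.
  rewrite lt_neqAle G_0 andbT eq_sym; apply/eqP => g0.
  by have := past_limit_zeta R w00; rewrite g0 mul0r leNgt divr_gt0.
have V0 : 0 <= frame_norm A0 (zeta_re w0) (zeta_im w0) by exact: frame_norm_ge0.
pose P := zeta_abs w0 + (past_limit w0 + 200 * zeta_abs w0) * (6 * (2 * U)).
have [t t0 ht] := perturb_small (frame_norm A0 (zeta_re w0) (zeta_im w0)) (200 * zeta_abs
  w0) P G_0
  (divr_gt0 dl0 (ltr0n R 2)).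
have [b [b0 bE]] : exists b, 0 < b /\ 200 * b * (1 + zeta_abs w0) = past_limit w0 / 2.
  have Z1 : 0 < 1 + zeta_abs w0 by rewrite ltr_pwDl.
  exists (past_limit w0 / 2 / (1 + zeta_abs w0) / 200); split; last by field;
    rewrite gt_eqF.
  by rewrite divr_gt0 ?ltr0n// divr_gt0// divr_gt0.
have [y0 _ _] := fo.
have y20 : 0 < fscale f ^+ 2 by rewrite exprn_gt0.
have bb0 : 0 < fscale f ^+ 2 * (3 / 10) * (past_limit w0 / 2) * dl
  by rewrite !mulr_gt0// ?invr_gt0.
have [na hna] := sigma_pow_small t0.
have [nb hnb] := sigma_pow_small b0.
have [nc hnc] := sigma_pow_small bb0.
(* na: quality close to cost; nb: the denominator form is at least half its
   limit at w0; nc: the denominator is large. *)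
pose n1 := maxn (maxn n0 m) (maxn na (maxn nb nc)).
have eta_gt0 : 0 < Num.min (Num.min (lid / 2) (dl / (1 + rho) * lid))
    (Num.min (cN / 2 ^+ m.+2) t).
  have q2 : 0 < dl / (1 + rho) * lid by rewrite mulr_gt0// divr_gt0// addr_gt0.
  have q3 : 0 < cN / 2 ^+ m.+2 by rewrite divr_gt0// exprn_gt0.
  by rewrite !lt_min t0 q2 q3 divr_gt0.
have [ns [ns1 ns10 hns]] := follow_path normN j n1 (j + j) fo c01 eta_gt0.
move: eta_gt0 hns; set eta := Num.min _ _ => eta0 hns.
have [eta1 eta2 eta3 eta4] : [/\ eta <= lid / 2, eta <= dl / (1 + rho) * lid,
    eta <= cN / 2 ^+ m.+2 & eta <= t].
  by split; rewrite /eta !ge_min lexx ?orbT.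
exists ns, n1; split.
  by split=> //; rewrite ?leq_max ?leqnn ?orbT.
split.
- have h1 : bounded_by (low_bound cN m) (upp_bound cN CN m) (planned j c (fbasis f) (j
  + j)).
    rewrite planned_end//; apply: bounded_rot => //=.
    have /andP[c0 c1] := c01; rewrite sqr_sqrtr; last by rewrite subr_ge0 exprn_ile1.
    by ring.
  apply: bounded_weaken (bounded_dist normN (hns _ (leqnn _)) h1).
    rewrite /low_bound in lm *; move: eta3; rewrite [2 ^+ m.+2]exprS invfM; lra.
  rewrite /upp_bound; move: eta3 pm; rewrite !exprS !invfM.
  have : 0 < cN / 2 ^+ m by rewrite divr_gt0// exprn_gt0.
  lra.
- move=> i iJ; apply: bounded_weaken (bounded_dist normN (hns _ iJ) (idb i iJ)).
    lra.
  rewrite UE; lra.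
- move=> i w iJ w_0; have /andP[_ iJ2] := iJ.
  have /andP[h1 _] := cost_dist normN w lid0 (idb i iJ2) (le_trans (hns i iJ2) eta2).
  apply: le_trans h1; have r1 : 0 < 1 + rho by rewrite addr_gt0.
  have d1 : dl / (1 + rho) <= 1 by rewrite ler_pdivrMr//; lra.
  apply: le_trans (_ : (1 - dl / (1 + rho)) * rho <= _).
    have : dl / (1 + rho) * rho <= dl.
      by rewrite mulrAC ler_pdivrMr// ler_wpM2l ?(ltW dl0)// lerDr.
    rewrite mulrBl mul1r; lra.
  by rewrite ler_wpM2l ?subr_ge0// hge.
exists i0, w0; have /andP[i00 i0J] := ij.
have [i' i0E] : exists i', i0 = i'.+1 by case: (i0) i00 => // i' _; exists i'.
have e0 : 0 <= eps n1 by exact/ltW/eps_ge0.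
have n1na : (na <= n1)%N by rewrite /n1 !leq_max leqnn ?orbT.
have n1nb : (nb <= n1)%N by rewrite /n1 !leq_max leqnn ?orbT.
have n1nc : (nc <= n1)%N by rewrite /n1 !leq_max leqnn ?orbT.
have e_t : eps n1 <= t by apply: le_trans (eps_le R n1) _; exact: hna.
have e_b : eps n1 <= b by apply: le_trans (eps_le R n1) _; exact: hnb.
have e1 : eps n1 <= 1.
  apply: le_trans (eps_le R n1) _; rewrite exprn_ile1// ltW ?sigma_gt0//.
  exact: sigma_lt1.
have pg : `| `|past (run ns f i0) w0| - past_limit w0| <= 200 * eps n1 * zeta_abs w0.
  rewrite i0E /=; apply: le_trans (step_past_limit w0 (run_ok i' fo ns10) (ns10 i')) _.
  by rewrite ler_wpM2r// ler_wpM2l ?ler0n// eps_anti.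
have nuF : frame_norm (fbasis (run ns f i0)) (zeta_re w0) (zeta_im w0) <=
  frame_norm A0 (zeta_re w0) (zeta_im w0) + eta * zeta_abs w0.
  apply: le_trans (frame_norm_dist normN _ A0 _ _) _; rewrite lerD2l ler_wpM2r ?hypot_ge0//.
  exact: hns.
have y_big : fscale f ^+ 2 * (3 / 10) / sigma ^+ ns 0 <= fscale (run ns f i0) ^+ 2.
  apply: le_trans (step_fscale_big fo (ns10 0)) _.
  have := run_fscale i' fo ns10; rewrite -i0E /= => h.
  rewrite lerXn2r ?nnegrE//.
    by case: (step_ok fo (ns10 0)) => /ltW.
  by case: (run_ok i0 fo ns10) => /ltW.
move: (normr_ge0 (past (run ns f i0) w0)) pg; set p :=
  `|past _ _| => p0 /ler_normlP[pg1 pg2].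
split=> //.
  have s0 := sigman_gt0 R (ns 0).
  have p2 : past_limit w0 / 2 <= p.
    have : 200 * eps n1 * zeta_abs w0 <= past_limit w0 / 2.
      rewrite -bE; apply: ler_pM; last by rewrite lerDr.
      - by apply: mulr_ge0 e0; rewrite ler0n.
      - exact: Z0.
      - by rewrite ler_wpM2l ?ler0n.
    lra.
  have sc := hnc _ (leq_trans n1nc (ns1 0)).
  apply: le_trans (_ : dl^-1 <= _); first by rewrite dlE invrK ler_nat.
  apply: le_trans (_ : fscale f ^+ 2 * (3 / 10) / sigma ^+ ns 0 * (past_limit w0 / 2) <= _).
    rewrite mulrAC ler_pdivlMr// -ler_pdivlMl ?invr_gt0// invrK mulrC.
    exact: sc.
  apply: ler_pM y_big p2; last by rewrite divr_ge0.
  apply: divr_ge0 (ltW s0); apply: mulr_ge0 (ltW y20) _.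
  by rewrite divr_ge0 ?ler0n.
pose e := Num.max (eps n1) eta.
have [ee1 ee2] : eps n1 <= e /\ eta <= e by rewrite !le_max !lexx orbT.
have e'0 : 0 <= e by apply: le_trans ee1.
have et : e <= t by rewrite ge_max e_t.
apply: le_trans (_ : Num.sqrt (past_limit w0 + e * (200 * zeta_abs w0)) *
  (frame_norm A0 (zeta_re w0) (zeta_im w0) + e * P) <= _); last first.
  apply: le_trans (ht e e'0 et) _; move: cost_lt; rewrite /cost -/A0; lra.
have Z200 : 0 <= 200 * zeta_abs w0 by rewrite mulr_ge0 ?ler0n.
have U12 : 0 <= 6 * (2 * U) by rewrite !mulr_ge0.
have eZ0 : 200 * eps n1 * zeta_abs w0 = eps n1 * (200 * zeta_abs w0) by ring.
have eZ : 200 * eps n1 * zeta_abs w0 <= e * (200 * zeta_abs w0) by rewrite eZ0 ler_wpM2r.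
have eZ' : 200 * eps n1 * zeta_abs w0 <= 200 * zeta_abs w0 by rewrite eZ0 ler_piMl.
have v_ge0 := frame_norm_ge0 normN (fbasis (run ns f i0)) (zeta_re w0) (zeta_im w0).
apply: ler_pM; rewrite ?sqrtr_ge0//.
- exact: addr_ge0 v_ge0 (mulr_ge0 p0 (mulr_ge0 U12 e0)).
- by apply: ler_wsqrtr; lra.
rewrite /P mulrDr addrA; apply: lerD.
  by apply: le_trans nuF _; rewrite lerD2l ler_wpM2r.
have -> : e * ((past_limit w0 + 200 * zeta_abs w0) * (6 * (2 * U))) =
  (past_limit w0 + 200 * zeta_abs w0) * (6 * (2 * U) * e) by ring.
apply: ler_pM p0 (mulr_ge0 U12 e0) _ _; first by lra.
by apply: ler_wpM2l.
Qed.

End Period.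

Section Assembly.
Variable R : realType.
Local Notation V := 'rV[R]_2.
Variable N : V -> R.
Hypothesis normN : is_norm N.
Local Notation zeta_re := (@zeta_re R).
Local Notation zeta_im := (@zeta_im R).
Local Notation sigma := (sigma R).
Local Notation eps n := (sigma ^+ n ^+ 3).
Local Notation frame := (frame R).
Local Notation sqrt3 := (Num.sqrt (3 : R)).
Local Notation theta := (theta R).
Local Notation bounded_by := (bounded_by N).

(** The frame of the identity matrix: q = c = (psi + 2 zeta_re) / (3 t^2), and
    zeta vanishes at the multiples of (t^2, t, 1). *)
Definition initial_frame : frame :=
  let y := (sqrt3 * theta)^-1 in
  Frame y 2 0 (theta ^+ 2 *: delta_mx 0 0 + theta *: delta_mx 0 1)
    (- y *: (delta_mx 0 0 + theta^-1 *: delta_mx 0 1),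
     (y / sqrt3) *: (delta_mx 0 0 - theta^-1 *: delta_mx 0 1)).

Lemma initial_frame_ok : frame_ok initial_frame.
Proof.
split; rewrite /= ?normr0 ?ger0_norm ?ler_nat//.
by rewrite invr_gt0 mulr_gt0 ?sqrt3_gt0 ?theta_gt0.
Qed.

Lemma initial_frame_of : frame_of id initial_frame.
Proof.
move=> [[a b] c].
have t0 : theta != 0 by rewrite gt_eqF// theta_gt0.
have s0 : sqrt3 != 0 by rewrite gt_eqF// sqrt3_gt0.
have s3 := sqrt3_sqr R.
split.
  rewrite /past /= exprVn exprMn s3; field; exact: t0.
apply/rowP => j; rewrite /comb /znum !mxE /=.
have [->|->] : j = 0 \/ j = 1.
  by case: j => [[|[|//]] lt]; [left|right]; apply: val_inj.
all: rewrite ?eqxx /= ?(mulr1, mulr0, addr0, add0r, subr0).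
all: by field; rewrite t0 s0.
Qed.

Lemma initial_frame_bounded : exists c C, [/\ 0 < c, 0 <=
  C & bounded_by c C (fbasis initial_frame)].
Proof.
have [k k0 kN] := is_norm_coercive normN.
have t0 := theta_gt0 R; have s0 := sqrt3_gt0 R; have s3 := sqrt3_sqr R.
have [y0 _ _] := initial_frame_ok.
exists (k * fscale initial_frame / 4), (basis_size N (fbasis initial_frame)); split.
- by rewrite divr_gt0// mulr_gt0.
- exact: basis_size_ge0.
move=> x y; rewrite frame_norm_size// andbT; apply: le_trans (kN _).
rewrite -!mulrA ler_wpM2l ?(ltW k0)//.
set v := comb _ x y; set S := `|v|; have S0 : 0 <= S by exact: normr_ge0.
have E0 : v ord0 0 = fscale initial_frame * (- x + y / sqrt3).
  by rewrite !mxE /=; field; rewrite !gt_eqF.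
have E1 : v ord0 1 * theta = fscale initial_frame * (- x - y / sqrt3).
  by rewrite !mxE /=; field; rewrite !gt_eqF.
move: E0 E1 (le_mx_norm v 0) (le_mx_norm v 1); rewrite -/S.
move: (v ord0 0) (v ord0 1) (fscale initial_frame) y0 => a b h h0 E0 E1 aS bS.
have t2 := theta_lt2 R.
have aS' : `|h * (- x + y / sqrt3)| <= 2 * S by rewrite -E0; lra.
have bS' : `|h * (- x - y / sqrt3)| <= 2 * S.
  by rewrite -E1 normrM (gtr0_norm t0) mulrC; apply: ler_pM => //; lra.
have : hypot x y <= 4 * S / h.
  apply: hypot_le; first by rewrite divr_ge0 ?mulr_ge0 ?(ltW h0).
  rewrite expr_div_n ler_pdivlMr ?exprn_gt0//.
  have sq u : `|u| <= 2 * S -> u ^+ 2 <= 4 * S ^+ 2.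
    move=> uS; rewrite -(real_normK (num_real u)).
    have -> : 4 * S ^+ 2 = (2 * S) ^+ 2 by ring.
    by rewrite lerXn2r ?nnegrE// mulr_ge0.
  have [A2 B2] := (sq _ aS', sq _ bS').
  have -> : (x ^+ 2 + y ^+ 2) * h ^+ 2 =
     (h * (- x + y / sqrt3)) ^+ 2 + (h * (- x - y / sqrt3)) ^+ 2
     - (h * (- x + y / sqrt3)) * (h * (- x - y / sqrt3)).
    transitivity (h ^+ 2 * (x ^+ 2 + 3 * y ^+ 2 / sqrt3 ^+ 2)).
      by rewrite s3; field.
    by field; rewrite gt_eqF.
  move: (h * (- x + y / sqrt3)) (h * (- x - y / sqrt3)) A2 B2 => p q A2 B2.
  have := sqr_ge0 (p + q); have := sqr_ge0 S; lra.
rewrite ler_pdivlMr//; move: (hypot x y) => z; lra.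
Qed.

(** Concatenation of the periods: stage k belongs to period k %/ J. *)
Lemma exact_liminf cN CN rho : 0 < cN -> 0 <= CN ->
  bounded_by cN CN (fbasis initial_frame) ->
  0 < rho -> rho <= cN / 20 ->
  exists x : V,
    (forall d, 0 < d -> exists Q, forall w, Q <= `|zden R w| -> rho - d <= quality N x w) /\
    (forall d Q, 0 < d -> exists w, Q <= `|zden R w| /\ quality N x w <= rho + d).
Proof.
move=> cN0 CN0 f0b rho0 rho_le.
have [J [lmin [U [J0 lmin0 per]]]] := one_period normN cN0 CN0 rho0 rho_le.
pose good m (f : frame) := frame_ok f /\
  bounded_by (low_bound cN m) (upp_bound cN CN m) (fbasis f).
have /choice[g gP] : forall p : nat * (frame * nat), exists r : (nat -> nat) * nat,
  good p.1 p.2.1 ->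
    [/\ (p.2.2 <= r.2)%N, (p.1 <= r.2)%N,
      forall i, (r.2 <= r.1 i)%N & forall i, sigma ^+ r.1 i <= 1 / 10] /\
    [/\ bounded_by (low_bound cN p.1.+1) (upp_bound cN CN p.1.+1) (fbasis (run r.1 p.2.1
      J)),
        forall i, (i <= J)%N -> bounded_by lmin U (fbasis (run r.1 p.2.1 i)),
        forall i w, (0 < i <= J)%N -> w != (0, 0, 0) ->
          rho - p.1.+1%:R^-1 <= cost N (fbasis (run r.1 p.2.1 i)) w &
        exists i w, [/\ (0 < i <= J)%N,
          p.1%:R <= fscale (run r.1 p.2.1 i) ^+ 2 * `|past (run r.1 p.2.1 i) w| &
          Num.sqrt `|past (run r.1 p.2.1 i) w| *
            (frame_norm N (fbasis (run r.1 p.2.1 i)) (zeta_re w) (zeta_im w) +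
              `|past (run r.1 p.2.1 i) w| * (6 * (2 * U) * eps r.2)) <= rho
                + p.1.+1%:R^-1]].
  move=> [m [f n0]] /=; have [[fo fb]|ng] := pselect (good m f).
    by have [ns [n1 h]] := per m f n0 fo fb; exists (ns, n1).
  by exists (id, 0%N).
pose T := fix T m := if m is m'.+1 then
    (run (g (m', T m')).1 (T m').1 J, (g (m', T m')).2)
  else (initial_frame, 0%N).
have Tgood m : good m (T m).1.
  elim: m => [|m IHm] /=.
    split; first exact: initial_frame_ok.
    apply: bounded_weaken f0b; first by rewrite /low_bound expr1; lra.
    by rewrite /upp_bound expr0 divr1; lra.
  have [[_ _ _ h10] [hb _ _ _]] := gP (m, T m) IHm; split=> //.
  by apply: run_ok => //; case: IHm.
pose ns m := (g (m, T m)).1; pose n1 m := (g (m, T m)).2.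
have perT m := gP (m, T m) (Tgood m).
pose n k := ns (k %/ J)%N (k %% J)%N.
pose fr := fix fr k := if k is k'.+1 then step (n k') (fr k') else initial_frame.
pose M := fix M k := if k is k'.+1 then step_map (n k') (M k') else (id : Z3 -> Z3).
have frS k : fr k.+1 = step (n k) (fr k) by [].
have MS k : M k.+1 = step_map (n k) (M k) by [].
have frE m i : (i <= J)%N -> fr (m * J + i)%N = run (ns m) (T m).1 i.
  elim: m i => [|m IHm] i.
    elim: i => // i IHi iJ; rewrite mul0n add0n frS.
    have := IHi (ltnW iJ); rewrite mul0n add0n => ->.
    by rewrite /n divn_small// modn_small.
  elim: i => [_|i IHi iJ].
    by rewrite addn0 mulSn addnC IHm.
  rewrite addnS frS IHi ?(ltnW iJ)//.
  by rewrite /n divnMDl// modnMDl divn_small// modn_small// addn0.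
have n_small k : sigma ^+ n k <= 1 / 10.
  by have [[_ _ _ h] _] := perT (k %/ J)%N; exact: h.
have fr_eq k : exists m i, [/\ (i < J)%N, k = (m * J + i)%N &
    fr k.+1 = run (ns m) (T m).1 i.+1].
  exists (k %/ J)%N, (k %% J)%N; rewrite ltn_mod J0 -divn_eq; split=> //.
  by rewrite -frE ?ltn_mod// addnS -divn_eq.
have fr_b k : bounded_by lmin U (fbasis (fr k)).
  case: k => [|k].
    have [_ [_ h _ _]] := perT 0; exact: (h 0 (leq0n J)).
  have [m [i [iJ _ ->]]] := fr_eq k.
  by have [_ [_ h _ _]] := perT m; apply: h.
have hC k : basis_size N (fbasis (fr k)) <= 2 * U by exact: bounded_basis_size (fr_b k).
have hc k x y : lmin * hypot x y <= frame_norm N (fbasis (fr k)) x y by have /andP[] :=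
  fr_b k x y.
have id_surj : forall w : Z3, exists w', M 0 w' = w by move=> w; exists w.
have [x hx] := limit_point_exists normN frS initial_frame_ok n_small hC.
have n1_mono m m' : (m <= m')%N -> (n1 m <= n1 m')%N.
  elim: m' => [|m' IHm']; first by rewrite leqn0 => /eqP ->.
  rewrite leq_eqVlt => /orP[/eqP -> //|/IHm' h]; apply: leq_trans h _.
  by have [[h _ _ _] _] := perT m'.+1.
have n_ge k m : (m * J <= k)%N -> (n1 m <= n k)%N.
  move=> mk; have [[_ _ h _] _] := perT (k %/ J)%N.
  by apply: leq_trans (h _); apply: n1_mono; rewrite leq_divRL.
have n1_ge m : (m <= n1 m)%N by have [[_ h _ _] _] := perT m.
have n_lim e : 0 < e -> exists k0, forall k, (k0 <= k)%N -> eps (n k) <= e.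
  move=> e0; have [m hm] := sigma_pow_small e0.
  exists (m * J)%N => k mk; apply: le_trans (eps_le R _) (hm _ _).
  exact: leq_trans (n1_ge m) (n_ge _ _ mk).
have inv_small (d : R) m : 0 < d -> (Num.truncn d^-1 <= m)%N -> m.+1%:R^-1 <= d.
  move=> d0 dm; rewrite invf_ple ?posrE ?ltr0n//.
  by apply: le_trans (ltW (truncnS_gt _)) _; rewrite ler_nat.
have cost_lim d : 0 < d -> exists k0, forall k w, (k0 <= k)%N -> w != (0, 0, 0) ->
   rho - d <= Num.sqrt (past_limit R w) * frame_norm N (fbasis (fr k)) (zeta_re w)
     (zeta_im w).
  move=> d0; exists (Num.truncn d^-1 * J).+1 => -[|k] w // kk w0.
  have [m [i [iJ kE ->]]] := fr_eq k.
  have [_ [_ _ h _]] := perT m; apply: le_trans (h i.+1 w _ w0); last by rewrite /= iJ.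
  rewrite lerD2l lerN2; apply: inv_small => //.
  rewrite ltnS kE in kk; rewrite -ltnS.
  have : (Num.truncn d^-1 * J < m.+1 * J)%N.
    by apply: leq_ltn_trans kk _; rewrite mulSn addnC ltn_add2r.
  by rewrite ltn_mul2r J0.
exists x; split.
  by move=> d d0; apply: (quality_liminf_ge normN frS MS initial_frame_ok
    initial_frame_of id_surj
    n_small lmin0 hC hc hx n_lim rho0 cost_lim d0).
move=> d Q d0; pose m := maxn (Num.truncn d^-1) (Num.truncn Q).+1.
have [_ [_ _ _ [i [w [/andP[i0 iJ] h1 h2]]]]] := perT m.
rewrite -!frE// in h1 h2.
exists (M (m * J + i)%N w); split.
  have [-> _] := fr_of frS MS initial_frame_ok initial_frame_of n_small (m * J + i) w.
  rewrite normrM (ger0_norm (sqr_ge0 _)); apply: le_trans h1.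
  apply: le_trans (ltW (truncnS_gt Q)) _; rewrite ler_nat; exact: leq_maxr.
have hk l : (m * J + i <= l)%N -> eps (n l) <= eps (n1 m).
  by move=> kl; apply: eps_anti; apply: n_ge; apply: leq_trans kl; exact: leq_addr.
have h3 : rho + m.+1%:R^-1 <= rho + d.
  by rewrite lerD2l inv_small// leq_maxl.
apply: (quality_le normN frS MS initial_frame_ok initial_frame_of n_small hx hk).
exact: le_trans h2 h3.
Qed.

End Assembly.

Theorem theorem1p2 (R : realType) (N : 'rV[R]_2 -> R) (normN : is_norm N) :
  exists rho0 : R,
    [/\ 0 < rho0,
        [set y%:E | y in `]rho0^-1, +oo[] `<=` Lagrange_spectrum2 N
      & forall rho : R, 0 < rho < rho0 ->
          exists x : 'rV[R]_2, ~ Q2 x /\ liminf_torus N x = rho%:E].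
Proof.
have [cN [CN [cN0 CN0 f0b]]] := initial_frame_bounded normN.
have main rho : 0 < rho < cN / 20 ->
    exists x : 'rV[R]_2, ~ Q2 x /\ liminf_torus N x = rho%:E.
  move=> /andP[rho0 rho_lt].
  have [x [low up]] := exact_liminf normN cN0 CN0 f0b rho0 (ltW rho_lt).
  exists x; split; first exact: liminf_torus_gt0_irrational rho0 low.
  exact: liminf_torus_eq.
have r0 : 0 < cN / 20 by rewrite divr_gt0.
exists (cN / 20); split=> //.
apply: spectrum_of_liminf => // rho /main[x [_ xE]].
by exists x.
Qed.
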